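(* Suppose that $b$ and $\sigma$ satisfy the following conditions. (i) There exist constants $K_1,K_2>0$ such that for all $x,y\in\mathbb{R}^d$ and $\mu,\nu\in\mathcal{P}_2(\mathbb{R}^d)$, $$2\langle x-y,b(x,\mu)-b(y,\nu)\rangle+\|\sigma(x,\mu)-\sigma(y,\nu)\|^2\leq -K_1|x-y|^2+K_2\mathbb{W}_2(\mu,\nu)^2.$$ (ii) There exists a constant $C>0$ such that $|b(0,\mu)|+\|\sigma(0,\mu)\|\leq C$ for all $\mu\in\mathcal{P}_2(\mathbb{R}^d)$. (iii) $\sigma(x,\mu)=\sigma_1(x)+\sigma_2(\mu)$ with $\sigma_1:\mathbb{R}^d\to\mathbb{R}^{d\times m}$ and $\sigma_2:\mathcal{P}_2(\mathbb{R}^d)\to\mathbb{R}^{d\times m}$, and there exist constants $l_1,l_2,d_2>0$ and $p_0\geq3$ such that for all $x\in\mathbb{R}^d$ and $\mu\in\mathcal{P}_2(\mathbb{R}^d)$, $$2\langle x,b(x,\mu)\rangle+(p_0-1)\|\sigma_1(x)\|^2\leq-l_1|x|^2+l_2\mathcal{W}_2(\mu)^2,\qquad \|\sigma_2(\mu)\|^2\leq d_2\mathcal{W}_2(\mu)^2.$$ Assume $l_1>l_2+2d_2$. Then, for any $j\in\mathbb{S}_N$ and $\Delta\in(0,1)$, the backward Euler-Maruyama numerical solution $Z^{j,N}_{t_k}$ is exponentially stable in the mean-square sense, i.e., $$\limsup_{k\to\infty}\frac{1}{k\Delta}\log\big(\mathbb{E}|Z^{j,N}_{t_k}|^2\big)\leq-\alpha^*_\Delta,$$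 where $\alpha^*_\Delta$ is a positive constant (depending on $\Delta$) satisfying $\lim_{\Delta\to0}\alpha^*_\Delta=l_1-l_2-2d_2$.
   Context: $(\Omega,\mathcal{F},(\mathcal{F}_t)_{t\ge0},\mathbb{P})$ is a complete filtered probability space satisfying the usual conditions. $|\cdot|$ is the Euclidean norm on $\mathbb{R}^d$ and $\|\cdot\|$ is the Frobenius norm on $\mathbb{R}^{d\times m}$. $\mathcal{P}_2(\mathbb{R}^d)$ is the set of probability measures on $\mathbb{R}^d$ with finite second moment, $\mathbb{W}_2$ is the 2-Wasserstein distance on it, and $\mathcal{W}_2(\mu)=\left(\int_{\mathbb{R}^d}|x|^2\mu(dx)\right)^{1/2}$. The coefficients $b:\mathbb{R}^d\times\mathcal{P}_2(\mathbb{R}^d)\to\mathbb{R}^d$ and $\sigma:\mathbb{R}^d\times\mathcal{P}_2(\mathbb{R}^d)\to\mathbb{R}^{d\times m}$ are Borel measurable and locally Lipschitz with respect to $x$. $X_0$ is a non-zero $\mathcal{F}_0$-measurable $\mathbb{R}^d$-valued random variable with $\mathbb{E}|X_0|^{p}<\infty$ for all $p\ge2$, and $W$ is an $m$-dimensional $(\mathcal{F}_t)$-Brownian motion. Let $N\geq 1$ be an integer, $\mathbb{S}_N=\{1,\dots,N\}$, and for $j\in\mathbb{S}_N$ let $(W^j,X_0^j)$ be independent copies of $(W,X_0)$. Stepsizes are of the form $\Delta=1/M$ with $M$ a positive integer, and $t_k=k\Delta$, $k=0,1,2,\dots$. The backward Euler-Maruyama scheme for the interacting particle system is the implicit scheme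 $$Z^{j,N}_{t_{k+1}}=Z^{j,N}_{t_k}+b(Z^{j,N}_{t_{k+1}},\mu^{Z,N}_{t_k})\Delta+\sigma(Z^{j,N}_{t_k},\mu^{Z,N}_{t_k})\Delta W^j_{t_k},\qquad Z^{j,N}_0=X^j_0,\quad j\in\mathbb{S}_N,$$ where $\Delta W^j_{t_k}=W^j_{t_{k+1}}-W^j_{t_k}$ and $\mu^{Z,N}_{t_k}=\frac1N\sum_{i=1}^N\delta_{Z^{i,N}_{t_k}}$. Convention: $\log 0=-\infty$.
   Formalization: The formal theorem additionally assumes that E‖σ_1(X_0)‖² is finite; without it the claim fails, since σ_1 may grow faster than any polynomial and E|Z_{t_k}|² can then be infinite for every k≥1. *)

(* Defs.v *)
From HB Require Import structures.
From mathcomp Require Import all_boot all_order all_algebra.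
From mathcomp Require Import all_classical all_reals all_analysis.
From mathcomp Require Import measurable_realfun.

Set Implicit Arguments.
Unset Strict Implicit.
Unset Printing Implicit Defensive.

Import Order.TTheory GRing.Theory Num.Theory.
Import numFieldNormedType.Exports.

Local Open Scope classical_set_scope.
Local Open Scope ring_scope.

(* Frobenius norm; on column vectors 'cV[R]_d = 'M[R]_(d, 1) it is the
   Euclidean norm.  The library's norm `|x| on matrices is the sup norm. *)
Definition fnorm (R : realType) (m n : nat) (A : 'M[R]_(m, n)) : R :=
  Num.sqrt (\sum_(i < m) \sum_(j < n) A i j ^+ 2).

Definition dotp (R : realType) (d : nat) (x y : 'cV[R]_d) : R :=
  \sum_(i < d) x i 0 * y i 0.

Definition borel (T : topologicalType) : set (set T) := <<s @open T >>.

(* R^d with its Borel sigma-algebra. *)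
Notation euclid R d := (g_sigma_algebraType (@open 'cV[R]_d)).

(* X is measurable from (domain, G) to the Borel sets of U. *)
Definition measurable_for (S : Type) (U : topologicalType) (G : set (set S))
    (X : S -> U) : Prop :=
  forall B, borel B -> G (X @^-1` B).

Section wasserstein.
Context (R : realType) (d : nat).
Local Open Scope ereal_scope.

Record prob2 := Prob2 {
  prob2_val :> probability (euclid R d) R;
  prob2_moment : \int[prob2_val]_x (fnorm x ^+ 2)%:E < +oo }.

Definition moment2 (mu : prob2) : R :=
  Num.sqrt (fine (\int[mu]_x (fnorm x ^+ 2)%:E)).

Definition coupling (mu nu : prob2)
    (pi : probability (euclid R d * euclid R d)%type R) : Prop :=
  forall A : set (euclid R d), measurable A ->
    pi (A `*` setT) = mu A /\ pi (setT `*` A) = nu A.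

(* The infimum is finite on prob2 (take the product coupling), so that fine
   only changes its type. *)
Definition wass2 (mu nu : prob2) : R :=
  Num.sqrt (fine (ereal_inf
    [set \int[pi]_z (fnorm (z.1 - z.2 : 'cV[R]_d) ^+ 2)%:E
      | pi in coupling mu nu])).

(* Open sets of R^d x P_2(R^d), the second factor with the metric wass2. *)
Definition open_coef : set (set ('cV[R]_d * prob2)) :=
  [set U | forall x mu, U (x, mu) -> exists2 e : R, (0 < e)%R &
     forall y nu, (fnorm (y - x)%R < e)%R -> (wass2 mu nu < e)%R -> U (y, nu)].

Definition borel_coef (V : topologicalType) (f : 'cV[R]_d -> prob2 -> V) : Prop :=
  measurable_for <<s open_coef >> (fun z => f z.1 z.2).

Definition loc_lipschitz (m n : nat)
    (f : 'cV[R]_d -> prob2 -> 'M[R]_(m, n)) : Prop :=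
  forall (mu : prob2) (r : R), exists L : R,
    forall x y, (fnorm x <= r)%R -> (fnorm y <= r)%R ->
      (fnorm (f x mu - f y mu) <= L * fnorm (x - y))%R.

End wasserstein.

Lemma measurable_fnorm_sq (R : realType) (d : nat) :
  measurable_fun [set: euclid R d]
    (EFin \o (fun x : euclid R d => fnorm (x : 'cV[R]_d) ^+ 2 : R)).
Proof.
have -> : (fun x : euclid R d => fnorm (x : 'cV[R]_d) ^+ 2 : R) =
    (fun x : euclid R d => \sum_(i < d) (x : 'cV[R]_d) i 0 ^+ 2 : R).
  apply/funext => x; rewrite /fnorm sqr_sqrtr.
    by apply: eq_bigr => i _; rewrite big_ord1.
  by apply: sumr_ge0 => i _; apply: sumr_ge0 => j _; rewrite sqr_ge0.
apply/measurable_EFinP/measurable_sum => i.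
apply: (@measurable_funX _ _ R setT (fun x : euclid R d => (x : 'cV[R]_d) i 0)).
apply: (measurability _ (RGenOpens.measurableE R)) => _ [_ [a [c ->] <-]].
rewrite setTI; apply: sub_sigma_algebra.
by apply: open_comp => [x _|]; [exact: coord_continuous|exact: interval_open].
Qed.

(* The proof of 0 < N is an argument so that the probability instance below
   can be inferred from the term. *)
Definition empirical_measure (R : realType) (d N : nat) of (0 < N)%N :
    ('I_N -> euclid R d) -> set (euclid R d) -> \bar R :=
  fun x A => ((N%:R^-1)%:E * \sum_(i < N) \d_(x i) A)%E.

Section empirical_measure_instances.
Context (R : realType) (d N : nat) (N0 : (0 < N)%N) (x : 'I_N -> euclid R d).
Let invN : {nonneg R} := (N%:R^-1)%:nng.
Local Open Scope ereal_scope.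

Local Notation empirical_measure := (empirical_measure N0 x).

Let dirac_family (n : nat) : {measure set (euclid R d) -> \bar R} :=
  \d_(x (insubd (Ordinal N0) n)).

Let empirical_msum :
  empirical_measure = mscale invN (msum dirac_family N).
Proof.
apply/funext => A; rewrite /empirical_measure /mscale /msum /=; congr (_ * _).
by apply: eq_bigr => i _; rewrite /dirac_family -[in LHS](valKd (Ordinal N0) i).
Qed.

Let empirical0 : empirical_measure set0 = 0.
Proof. by rewrite empirical_msum measure0. Qed.

Let empirical_ge0 A : 0 <= empirical_measure A.
Proof. by rewrite empirical_msum. Qed.

Let empirical_sigma_additive : semi_sigma_additive empirical_measure.
Proof. by rewrite empirical_msum; exact: measure_semi_sigma_additive. Qed.

HB.instance Definition _ := isMeasure.Build _ _ _ empirical_measure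
  empirical0 empirical_ge0 empirical_sigma_additive.

Let empirical_setT : empirical_measure setT = 1.
Proof.
rewrite /empirical_measure.
under eq_bigr do rewrite diracT.
rewrite sumEFin -EFinM; congr EFin.
by rewrite sumr_const card_ord mulVf// pnatr_eq0 -lt0n.
Qed.

HB.instance Definition _ :=
  Measure_isProbability.Build _ _ _ empirical_measure empirical_setT.

Lemma empirical_moment :
  \int[empirical_measure]_y (fnorm (y : 'cV[R]_d) ^+ 2)%:E < +oo.
Proof.
have f0 (y : euclid R d) : setT y -> 0 <= (fnorm (y : 'cV[R]_d) ^+ 2)%:E.
  by move=> _; rewrite lee_fin sqr_ge0.
have mf := @measurable_fnorm_sq R d.
rewrite (eq_measure_integral (mscale invN (msum dirac_family N)));
  last by move=> A _ _; rewrite /= empirical_msum.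
rewrite ge0_integral_mscale// ge0_integral_measure_sum//.
under eq_bigr do rewrite integral_dirac// diracT mul1e.
by rewrite sumEFin -EFinM ltry.
Qed.

Definition empirical : prob2 R d := Prob2 empirical_moment.

End empirical_measure_instances.

Section stochastic_basis.
Context (R : realType) (disp : measure_display) (T : measurableType disp).
Variables (P : probability T R) (F : R -> set (set T)).
Local Open Scope ereal_scope.

(* Only the times t >= 0 of a filtration or of a process are meaningful. *)
Definition usual_conditions : Prop :=
  [/\ measure_is_complete P,
      forall t : R, (0 <= t)%R -> sigma_algebra setT (F t) /\ F t `<=` measurable,
      forall s t : R, (0 <= s)%R -> (s <= t)%R -> F s `<=` F t,
      P.-negligible `<=` F 0%R
    & forall (t : R) A, (0 <= t)%R -> (forall s, (t < s)%R -> F s A) -> F t A].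

Definition brownian_motion (m : nat) (W : R -> T -> 'cV[R]_m) : Prop :=
  [/\ {ae P, forall w, W 0%R w = 0%R},
      {ae P, forall w, {within `[0%R, +oo[, continuous (W ^~ w)}},
      forall t : R, (0 <= t)%R -> measurable_for (F t) (W t),
      forall (s t : R) G B, (0 <= s)%R -> (s < t)%R -> F s G -> borel B ->
        P (G `&` ((fun w => W t w - W s w)%R @^-1` B)) =
        P G * P ((fun w => W t w - W s w)%R @^-1` B)
    & forall (s t : R) (A : 'I_m -> set R), (0 <= s)%R -> (s < t)%R ->
        (forall i, measurable (A i)) ->
        P [set w | forall i, A i ((W t w - W s w) i 0)%R] =
        \prod_(i < m) normal_prob 0 (Num.sqrt (t - s)) (A i)].

Section copies.
Variables (d m : nat).
Implicit Types (X : T -> 'cV[R]_d) (W : R -> T -> 'cV[R]_m).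

(* (X', W') and (X, W) have the same finite-dimensional laws, that is the same
   law on R^d x (R^m)^[0, +oo[. *)
Definition same_law X' W' X W : Prop :=
  forall (n : nat) (t : 'I_n -> R) A (B : 'I_n -> set 'cV[R]_m),
    (forall i, (0 <= t i)%R) -> borel A -> (forall i, borel (B i)) ->
    P [set w | A (X' w) /\ forall i, B i (W' (t i) w)] =
    P [set w | A (X w) /\ forall i, B i (W (t i) w)].

Definition generated X W : set (set T) :=
  <<s [set E | (exists2 A, borel A & E = X @^-1` A) \/
               (exists (t : R) A, [/\ (0 <= t)%R, borel A & E = W t @^-1` A])] >>.

Definition independent_copies (N : nat) (Xj : 'I_N -> T -> 'cV[R]_d)
    (Wj : 'I_N -> R -> T -> 'cV[R]_m) X W : Prop :=
  (forall j, same_law (Xj j) (Wj j) X W) /\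
  (forall E : 'I_N -> set T, (forall j, generated (Xj j) (Wj j) (E j)) ->
    P [set w | forall j, E j w] = \prod_(j < N) P (E j)).

Definition initial_condition X : Prop :=
  [/\ measurable_for (F 0%R) X,
      ~ {ae P, forall w, X w = 0%R}
    & forall p : R, (2 <= p)%R -> 'E_P[fun w => (fnorm (X w) `^ p)%R] < +oo].

Definition stepsize (D : R) : Prop := exists2 M : nat, (0 < M)%N & D = (M%:R^-1)%R.

(* Z k j stands for Z^{j,N}_{t_k}, with t_k = k * D. *)
Definition backward_euler (b : 'cV[R]_d -> prob2 R d -> 'cV[R]_d)
    (sigma : 'cV[R]_d -> prob2 R d -> 'M[R]_(d, m)) (N : nat) (N0 : (0 < N)%N)
    (Xj : 'I_N -> T -> 'cV[R]_d) (Wj : 'I_N -> R -> T -> 'cV[R]_m)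
    (D : R) (Z : nat -> 'I_N -> T -> 'cV[R]_d) : Prop :=
  let muZ k w := empirical N0 (fun i => Z k i w) in
  [/\ forall k j, measurable_for (F (k%:R * D)%R) (Z k j),
      forall j, {ae P, forall w, Z 0%N j w = Xj j w}
    & forall k j, {ae P, forall w,
        Z k.+1 j w = (Z k j w + D *: b (Z k.+1 j w) (muZ k w) +
          sigma (Z k j w) (muZ k w) *m
            (Wj j (k.+1%:R * D) w - Wj j (k%:R * D) w))%R}].

End copies.
End stochastic_basis.

(* Main.v *)
(* Write x = Z_{k+1}, beta = b(x, mu_k) and y = Z_k + sigma(Z_k, mu_k) dW, so that
   x - D beta = y.  Expanding |x - D beta|^2 and using |c x + D beta|^2 >= 0 for
   some c >= 0, condition (iii) gives, since p0 - 1 >= 2,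
     A |x|^2 + 2 D (1 + c) |sigma1 x|^2 <= |y|^2 + D (1 + c) l2 W_2(mu_k)^2,
   with A = 1 - c^2 + D (1 + c) l1.  The increment dW is centred with covariance D Id
   and independent of F_{t_k}, so E|y|^2 <= E|Z_k|^2 + D E|sigma(Z_k, mu_k)|^2.
   Summing over the particles, V_k = sum_j (A E|Z_k^j|^2 + 2 D (1 + c) E|sigma1(Z_k^j)|^2)
   satisfies V_{k+1} <= q V_k as soon as
     1 + 2 D d2 + D (1 + c) l2 <= q A   and   1 <= q (1 + c).
   A choice of c proportional to D^(3/4) makes (1 - q) / D converge to
   l1 - l2 - 2 d2. *)

Require Import Defs.
From HB Require Import structures.
From mathcomp Require Import all_boot all_order all_algebra.
From mathcomp Require Import all_classical all_reals all_analysis.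
From mathcomp Require Import measurable_realfun ring lra.

Set Implicit Arguments.
Unset Strict Implicit.
Unset Printing Implicit Defensive.

Import Order.TTheory GRing.Theory Num.Theory.
Import numFieldNormedType.Exports.

Local Open Scope classical_set_scope.
Local Open Scope ring_scope.

(** * Moments of the normal distribution *)

Section density.
Context {disp : measure_display} {T : measurableType disp} {R : realType}.
Variables (mu nu : {measure set T -> \bar R}) (g : T -> R).
Hypotheses (g0 : forall x, 0 <= g x) (mg : measurable_fun setT g).
Hypothesis nuE : forall A, measurable A ->
  (nu A = \int[mu]_(x in A) (g x)%:E)%E.
Local Open Scope ereal_scope.
Import HBNNSimple.

Let mEg : measurable_fun setT (EFin \o g).
Proof. exact/measurable_EFinP. Qed.

Let integral_density_nnsfun (h : {nnsfun T >-> R}) :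
  \int[nu]_x (h x)%:E = \int[mu]_x ((h x)%:E * (g x)%:E).
Proof.
under eq_integral do rewrite fimfunE -fsumEFin//.
rewrite ge0_integral_fsum//; last 2 first.
- by move=> r; apply/measurable_EFinP/measurable_funM.
- by move=> r x _; exact: nnfun_muleindic_ge0.
under [RHS]eq_integral => x _.
  rewrite fimfunE -fsumEFin// ge0_mule_fsuml; last first.
    by move=> r; exact: nnfun_muleindic_ge0.
  over.
rewrite ge0_integral_fsum//; last 2 first.
- by move=> r; apply: emeasurable_funM => //;
    apply/measurable_EFinP/measurable_funM.
- by move=> r x _; rewrite mule_ge0 ?lee_fin//; exact: nnfun_muleindic_ge0.
apply: eq_fsbigr => r rh.
have r0 : (0 <= r)%R by move: rh; rewrite inE => -[t _ <-].
under eq_integral do rewrite EFinM.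
rewrite integralZl_indic_nnsfun//.
under [RHS]eq_integral do rewrite EFinM -muleA.
rewrite ge0_integralZl//.
- under [X in _ = _ * X]eq_integral do rewrite muleC.
  rewrite integral_indic// setIT nuE// integral_mkcond; congr (_ * _).
  apply: eq_integral => x _; by rewrite epatch_indic.
- apply: emeasurable_funM => //.
  exact/measurable_EFinP.
- by move=> t _; rewrite mule_ge0 ?lee_fin.
Qed.

Lemma ge0_integral_density (f : T -> \bar R) :
  measurable_fun setT f -> (forall x, 0 <= f x) ->
  \int[nu]_x f x = \int[mu]_x (f x * (g x)%:E).
Proof.
move=> mf f0; pose h := nnsfun_approx measurableT mf.
have fE x : f x = lim ((EFin \o h n) x @[n --> \oo]).
  by apply/esym/cvg_lim => //; exact: cvg_nnsfun_approx.
under eq_integral do rewrite fE.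
rewrite monotone_convergence//; last 3 first.
- by move=> n; exact/measurable_EFinP.
- by move=> n x _; rewrite lee_fin.
- by move=> x _ a b ab; rewrite lee_fin; exact/lefP/nd_nnsfun_approx.
have fgE x : f x * (g x)%:E = lim (((h n x)%:E * (g x)%:E) @[n --> \oo]).
  apply/esym/cvg_lim => //; apply: cvgeZr => //.
  exact: cvg_nnsfun_approx.
under [RHS]eq_integral do rewrite fgE.
rewrite monotone_convergence//; last 3 first.
- by move=> n; apply: emeasurable_funM => //; exact/measurable_EFinP.
- by move=> n x _; rewrite mule_ge0 ?lee_fin.
- move=> x _ a b ab; rewrite lee_wpmul2r ?lee_fin//.
  exact/lefP/nd_nnsfun_approx.
by under eq_fun do rewrite integral_density_nnsfun.
Qed.

End density.

Section gaussian_moments.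
Context {R : realType}.
Variable s : R.
Hypothesis s0 : s != 0.
Local Notation mu := lebesgue_measure.
Local Notation g := (normal_pdf 0 s).

Let gE x : g x = normal_peak s * expR (- x ^+ 2 / (s ^+ 2 *+ 2)).
Proof. by rewrite normal_pdfE// /normal_fun subr0. Qed.

Let g_ge0 x : 0 <= g x. Proof. exact: normal_pdf_ge0. Qed.

Let is_derive_g (x : R) :
  is_derive x (1 : R) (fun x : R => - s ^+ 2 * g x) (x * g x).
Proof.
have -> : (fun x : R => - s ^+ 2 * g x) =
    (fun x : R =>
      (- s ^+ 2 * normal_peak s) * expR (- (s ^+ 2 *+ 2)^-1 * x ^+ 2)).
  by apply/funext => y; rewrite gE mulrA; congr (_ * expR _);
    rewrite mulrC mulrN mulNr.
apply: trigger_derive; rewrite gE /GRing.scale /=.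
rewrite (_ : - x ^+ 2 / (s ^+ 2 *+ 2) = - (s ^+ 2 *+ 2)^-1 * x ^+ 2);
  last by rewrite mulrC mulrN mulNr.
rewrite -mulr_natr; field.
by rewrite s0.
Qed.

Let cg : continuous g. Proof. exact: continuous_normal_pdf. Qed.

Let cxg : continuous (fun x : R => x * g x).
Proof. by move=> x; apply: cvgM; [exact: cvg_id|exact: cg]. Qed.

Let normal_moment2_segment (n : nat) :
  (\int[mu]_(x in `[(- n.+1%:R)%R, (n.+1%:R : R)%R]) (x * (x * g x))%:E
   <= (s ^+ 2)%:E)%E.
Proof.
have n0 : (0 : R) < n.+1%:R by rewrite ltr0n.
have nN : - n.+1%:R < n.+1%:R :> R by rewrite gtrN.
have cG : continuous (fun x : R => - s ^+ 2 * g x).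
  by move=> x; apply: cvgM; [exact: cvg_cst|exact: cg].
rewrite (@integration_by_parts _ id (fun x => - s ^+ 2 * g x) (cst 1)
  (fun x => x * g x))//.
- under eq_integral do rewrite mul1r mulNr EFinN.
  rewrite integral_ge0N//; last by move=> x _;
    rewrite lee_fin mulr_ge0 ?sqr_ge0.
  rewrite oppeK; under eq_integral do rewrite EFinM.
  rewrite ge0_integralZl//; last 3 first.
  + by apply/measurable_EFinP/measurable_funTS; exact: measurable_normal_pdf.
  + by move=> x _; rewrite lee_fin.
  + by rewrite lee_fin sqr_ge0.
  rewrite -[leRHS]add0e; apply: leeD.
    rewrite lee_fin subr_le0 (@le_trans _ _ 0)//.
      by rewrite mulNr mulrN oppr_le0 (mulr_ge0 (ltW n0))// mulr_ge0 ?sqr_ge0.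
    by rewrite (mulNr (s ^+ 2)) mulrNN (mulr_ge0 (ltW n0))// mulr_ge0 ?sqr_ge0.
  rewrite -[leRHS]mule1 lee_wpmul2l ?lee_fin ?sqr_ge0//.
  rewrite -(integral_normal_pdf 0 s); apply: ge0_subset_integral => //.
    by apply/measurable_EFinP; exact: measurable_normal_pdf.
  by move=> x _; rewrite lee_fin.
- exact/continuous_subspaceT/cst_continuous.
- split.
  + by move=> x _; exact: derivable_id.
  + exact: cvg_at_right_filter.
  + exact: cvg_at_left_filter.
- by move=> x _; rewrite derive1E derive_id.
- exact/continuous_subspaceT.
- split.
  + by move=> x _; have [] := is_derive_g x.
  + exact/cvg_at_right_filter/cG.
  + exact/cvg_at_left_filter/cG.
- by move=> x _; rewrite derive1E; have [_ ->] := is_derive_g x.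
Qed.

Lemma normal_pdf_moment2 :
  (\int[mu]_x ((x ^+ 2)%:E * (g x)%:E) <= (s ^+ 2)%:E)%E.
Proof.
pose F (n : nat) := `[- n.+1%:R, n.+1%:R : R]%classic.
have UF : \bigcup_n F n = [set: R].
  apply/seteqP; split => // x _; exists (Num.bound `|x|) => //=.
  have := archi_boundP (normr_ge0 x).
  by rewrite /F/= in_itv/= -ler_norml -natr1 => /ltW /le_trans; apply;
    rewrite lerDl.
under eq_integral do rewrite -EFinM expr2 -mulrA.
rewrite -UF.
have cvgF : (\int[mu]_(x in F i) (x * (x * g x))%:E @[i --> \oo] -->
    \int[mu]_(x in \bigcup_i F i) (x * (x * g x))%:E)%E.
  apply: (@ge0_nondecreasing_set_cvg_integral _ (measurableTypeR R)).
  - apply/nondecreasing_seqP => n; rewrite subsetEset => x.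
    rewrite /F/= !in_itv/= -!ler_norml => /le_trans; apply.
    by rewrite ler_nat.
  - by move=> n; exact: measurable_itv.
  - move=> n; apply/measurable_EFinP/measurable_funTS/measurable_funM => //.
    by apply: measurable_funM => //; exact: measurable_normal_pdf.
  - by move=> n x _; rewrite lee_fin mulrA mulr_ge0// -expr2 sqr_ge0.
rewrite -(cvg_lim _ cvgF)//; apply: lime_le; first by apply/cvg_ex; eexists;
  exact: cvgF.
by apply: nearW => n; exact: normal_moment2_segment.
Qed.

Lemma normal_prob_sym (A : set R) : measurable A ->
  normal_prob 0 s (-%R @^-1` A) = normal_prob 0 s A.
Proof.
move=> mA; rewrite /normal_prob.
transitivity
  (\int[pushforward mu (-%R : R -> measurableTypeR R)]_(y in A) (g y)%:E)%E.
  rewrite ge0_integral_pushforward//.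
  - apply: eq_integral => x _ /=.
    by rewrite !gE sqrrN.
  - by apply/measurable_EFinP/measurable_funTS; exact: measurable_normal_pdf.
  - by move=> x _; rewrite lee_fin.
by apply: eq_measure_integral => //= B mB BA; exact: lebesgue_measureN.
Qed.

End gaussian_moments.

Section normal_random_variable.
Context {disp : measure_display} {T : measurableType disp} {R : realType}.
Variables (P : probability T R) (X : T -> R) (s : R).
Hypotheses (s0 : s != 0) (mX : measurable_fun setT X).
Hypothesis XE : forall A, measurable A -> P (X @^-1` A) = normal_prob 0 s A.

(* [lebesgue_measure] and [normal_prob] live on [measurableTypeR R], which has
   the measurable sets of [R] but another display. *)
Let X' : {mfun T >-> measurableTypeR R} :=
  HB.pack (X : T -> measurableTypeR R)
    (isMeasurableFun.Build _ _ _ (measurableTypeR R) X mX).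

Lemma normal_moment2_le : (\int[P]_w (X w ^+ 2)%:E <= (s ^+ 2)%:E)%E.
Proof.
have mf : measurable_fun [set: measurableTypeR R] (fun x : R => (x ^+ 2)%:E).
  by apply/measurable_EFinP/measurable_funX.
have -> : (\int[P]_w (X w ^+ 2)%:E = \int[distribution P X']_x (x ^+ 2)%:E)%E.
  by rewrite ge0_integral_distribution// => y; rewrite lee_fin sqr_ge0.
rewrite (@ge0_integral_density _ _ _ lebesgue_measure _ (normal_pdf 0 s))//.
- exact: normal_pdf_moment2.
- by move=> x; exact: normal_pdf_ge0.
- exact: measurable_normal_pdf.
- by move=> x; rewrite lee_fin sqr_ge0.
Qed.

Lemma normal_sqr_integrable : P.-integrable setT (fun w => (X w ^+ 2)%:E).
Proof.
apply/integrableP; split; first exact/measurable_EFinP/measurable_funX.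
under eq_integral do rewrite gee0_abs ?lee_fin ?sqr_ge0//.
by rewrite (le_lt_trans normal_moment2_le)// ltry.
Qed.

Lemma normal_integrable : P.-integrable setT (EFin \o X).
Proof.
apply: (@le_integrable _ _ _ _ _ _ _
  (cst 1%:E \+ (fun w => (X w ^+ 2)%:E))%E) => //.
- exact/measurable_EFinP.
- move=> w _ /=; rewrite lee_fin [leRHS]ger0_norm ?addr_ge0 ?sqr_ge0//.
  rewrite ler_norml; apply/andP; split; nra.
- by apply: integrableD => //; [exact: finite_measure_integrable_cst|
    exact: normal_sqr_integrable].
Qed.

Lemma normal_mean0 : (\int[P]_w (X w)%:E = 0)%E.
Proof.
have mN : measurable_fun setT (fun w => - X w) by exact: measurableT_comp.
pose N' : {mfun T >-> measurableTypeR R} :=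
  HB.pack ((fun w => - X w) : T -> measurableTypeR R)
    (isMeasurableFun.Build _ _ _ (measurableTypeR R) (fun w => - X w) mN).
have NE : (\int[P]_w (- X w)%:E = - \int[P]_w (X w)%:E)%E.
  under eq_integral do rewrite EFinN -mulN1e.
  by rewrite integralZl//; [rewrite mulN1e|exact: normal_integrable].
have : (\int[P]_w (X w)%:E = \int[P]_w (- X w)%:E)%E.
  rewrite -(@integral_distribution _ _ _ _ _ P X' EFin)//;
    last exact: normal_integrable.
  rewrite -(@integral_distribution _ _ _ _ _ P N' EFin)//; last first.
    exact: (integrableN normal_integrable).
  apply: eq_measure_integral => //= A mA _.
  rewrite /distribution /pushforward/= XE//.
  rewrite -normal_prob_sym// -XE//.
  by rewrite -[X in measurable X]setTI; apply: (oppr_measurable measurableT mA).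
rewrite NE; have := integrable_fin_num measurableT normal_integrable.
case: (\int[P]_w _)%E => //= r _ [] rE; congr EFin; lra.
Qed.

End normal_random_variable.

(** * Expectation of products of independent variables *)

Section independence.
Context {disp d1 d2 : measure_display} {T : measurableType disp}
  {T1 : measurableType d1} {T2 : measurableType d2} {R : realType}.
Variables (P : probability T R) (X : T -> T1) (Y : T -> T2).
Hypotheses (mX : measurable_fun setT X) (mY : measurable_fun setT Y).
Local Open Scope ereal_scope.
Hypothesis XY : forall A B, measurable A -> measurable B ->
  P (X @^-1` A `&` Y @^-1` B) = P (X @^-1` A) * P (Y @^-1` B).

Let X' : {mfun T >-> T1} := HB.pack X (isMeasurableFun.Build _ _ _ _ _ mX).
Let Y' : {mfun T >-> T2} := HB.pack Y (isMeasurableFun.Build _ _ _ _ _ mY).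

Let mXY : measurable_fun setT (fun w => (X w, Y w)).
Proof. exact: measurable_fun_pair. Qed.

Let XY' : {mfun T >-> (T1 * T2)%type} :=
  HB.pack (fun w => (X w, Y w)) (isMeasurableFun.Build _ _ _ _ _ mXY).

Let distribution_pair (A : set (T1 * T2)) : measurable A ->
  distribution P XY' A = (distribution P X' \x distribution P Y') A.
Proof.
move=> mA; by apply/esym/product_measure_unique => //= B C mB mC; rewrite -XY.
Qed.

Lemma ge0_integral_indep (f : T1 -> \bar R) (g : T2 -> \bar R) :
  measurable_fun setT f -> measurable_fun setT g ->
  (forall x, 0 <= f x) -> (forall y, 0 <= g y) ->
  \int[P]_w (f (X w) * g (Y w)) = \int[P]_w f (X w) * \int[P]_w g (Y w).
Proof.
move=> mf mg f0 g0.
have mfg : measurable_fun setT (fun z : T1 * T2 => f z.1 * g z.2).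
  by apply: emeasurable_funM; exact: measurableT_comp.
have fg0 z : 0 <= f z.1 * g z.2 by rewrite mule_ge0.
transitivity (\int[distribution P XY']_z (f z.1 * g z.2)).
  by rewrite ge0_integral_distribution.
transitivity (\int[distribution P X' \x distribution P Y']_z (f z.1 * g z.2)).
  by apply: eq_measure_integral => A mA _; exact: distribution_pair.
rewrite fubini_tonelli1// /fubini_F/=.
under eq_integral do rewrite ge0_integralZl//.
rewrite ge0_integralZr//; last by apply: integral_ge0.
by rewrite !ge0_integral_distribution.
Qed.

Variables (f : T1 -> R) (g : T2 -> R).
Hypotheses (mf : measurable_fun setT f) (mg : measurable_fun setT g).
Hypotheses (If : P.-integrable setT (EFin \o (f \o X)))
           (Ig : P.-integrable setT (EFin \o (g \o Y))).

Let mEf : measurable_fun setT (EFin \o f). Proof. exact/measurable_EFinP. Qed.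
Let mEg : measurable_fun setT (EFin \o g). Proof. exact/measurable_EFinP. Qed.

Lemma integrable_indep :
  P.-integrable setT (fun w => (f (X w) * g (Y w))%:E).
Proof.
apply/integrableP; split.
  by apply/measurable_EFinP/measurable_funM; exact: measurableT_comp.
under eq_integral do rewrite EFinM abseM.
rewrite (@ge0_integral_indep (abse \o (EFin \o f)) (abse \o (EFin \o g)))//;
  [|exact: measurableT_comp|exact: measurableT_comp|
    by move=> ?; exact: abse_ge0|by move=> ?; exact: abse_ge0].
case/integrableP : If => _ foo; case/integrableP : Ig => _ goo.
have f0 : 0 <= \int[P]_w `|(EFin \o f) (X w)| by exact: integral_ge0.
by apply: lte_mul_pinfty => //; rewrite ge0_fin_numE.
Qed.

Lemma integral_indep :
  \int[P]_w (f (X w) * g (Y w))%:E =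
  \int[P]_w (f (X w))%:E * \int[P]_w (g (Y w))%:E.
Proof.
have mfg : measurable_fun setT (fun z : T1 * T2 => (f z.1 * g z.2)%:E).
  by apply/measurable_EFinP/measurable_funM; exact: measurableT_comp.
have Ifg : (distribution P X' \x distribution P Y').-integrable setT
    (fun z => (f z.1 * g z.2)%:E).
  apply/integrableP; split => //.
  rewrite (eq_measure_integral (distribution P XY')); last first.
    by move=> A mA _; exact/esym/distribution_pair.
  rewrite ge0_integral_distribution//; last exact: measurableT_comp.
  by case/integrableP : integrable_indep.
transitivity (\int[distribution P XY']_z (f z.1 * g z.2)%:E).
  by rewrite integral_distribution//; exact: integrable_indep.
transitivity
  (\int[distribution P X' \x distribution P Y']_z (f z.1 * g z.2)%:E).
  by apply: eq_measure_integral => A mA _; exact: distribution_pair.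
rewrite -integral12_prod_meas1//=.
have Igd : (distribution P Y').-integrable setT (EFin \o g).
  exact: integrable_pushforward.
have Ifd : (distribution P X').-integrable setT (EFin \o f).
  exact: integrable_pushforward.
rewrite (eq_integral (fun x => (f x)%:E * \int[distribution P Y']_y (g y)%:E));
  last by move=> x _; rewrite /fubini_F/= -integralZl.
have gfin := integrable_fin_num measurableT Igd.
rewrite -(fineK gfin) integralZr// fineK//.
by rewrite !integral_distribution.
Qed.
End independence.

Section real_integrals.
Context {disp : measure_display} {T : measurableType disp} {R : realType}.
Variable P : {measure set T -> \bar R}.
Implicit Types f g : T -> R.

Local Notation intg f := (P.-integrable setT (EFin \o f)).

Lemma integrable_EFinD f g : intg f -> intg g -> intg (fun w => f w + g w).
Proof. by move=> fi gi; exact: (integrableD measurableT fi gi). Qed.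

Lemma integrable_EFinZl (k : R) f : intg f -> intg (fun w => k * f w).
Proof. by move=> fi; exact: (integrableZl measurableT k fi). Qed.

Lemma integrable_EFin_sum (I : Type) (r : seq I) (f : I -> T -> R) :
  (forall i, intg (f i)) -> intg (fun w => \sum_(i <- r) f i w).
Proof.
move=> fi; elim: r => [|i r IHr].
  under eq_fun do rewrite big_nil; exact: integrable0.
by under eq_fun do rewrite big_cons; exact: integrable_EFinD.
Qed.

Lemma Rintegral_sum (I : Type) (r : seq I) (f : I -> T -> R) :
  (forall i, intg (f i)) ->
  \int[P]_w (\sum_(i <- r) f i w) = \sum_(i <- r) \int[P]_w f i w.
Proof.
move=> fi; elim: r => [|i r IHr].
  rewrite big_nil; under eq_Rintegral do rewrite big_nil.
  by rewrite /Rintegral integral0.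
rewrite big_cons -IHr -RintegralD//; last exact: integrable_EFin_sum.
by apply: eq_Rintegral => w _; rewrite big_cons.
Qed.

Lemma integrable_le f g : measurable_fun setT f ->
  (forall w, `|f w| <= g w) -> intg g -> intg f.
Proof.
move=> mf fg; apply: le_integrable => //; first exact/measurable_EFinP.
by move=> w _ /=; rewrite lee_fin (le_trans (fg w))// ler_norm.
Qed.

Lemma integrable_mul f g : measurable_fun setT f -> measurable_fun setT g ->
  intg (fun w => f w ^+ 2) -> intg (fun w => g w ^+ 2) ->
  intg (fun w => f w * g w).
Proof.
move=> mf mg fi gi; apply: (integrable_le _ _ (integrable_EFinD fi gi)).
  exact: measurable_funM.
by move=> w; rewrite ler_norml; apply/andP; split; nra.
Qed.

Lemma ae_le_integrable f g : measurable_fun setT f -> (forall w, 0 <= f w) ->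
  intg g -> {ae P, forall w, f w <= g w} ->
  intg f /\ \int[P]_w f w <= \int[P]_w g w.
Proof.
move=> mf f0 ig fg.
have mg : measurable_fun setT g by exact/measurable_EFinP/(measurable_int _ ig).
have le : (\int[P]_w (f w)%:E <= \int[P]_w (`|g w|)%:E)%E.
  apply: ae_ge0_le_integral => //.
  - by move=> w _; rewrite lee_fin.
  - by apply/measurable_EFinP.
  - by apply/measurable_EFinP; exact: measurableT_comp.
  - by apply: filterS fg => w fgw _; rewrite lee_fin (le_trans fgw)// ler_norm.
have fi : intg f.
  apply/integrableP; split; first exact/measurable_EFinP.
  under eq_integral do rewrite gee0_abs ?lee_fin//.
  by apply: le_lt_trans le _; case/integrableP : ig.
split=> //; rewrite -subr_ge0 -RintegralB// /Rintegral.
have -> : (\int[P]_w (g w - f w)%:E = \int[P]_w `|g w - f w|%:E)%E.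
  apply: ae_eq_integral => //.
  - by apply/measurable_EFinP/measurable_funB.
  - by apply/measurable_EFinP/measurableT_comp => //; exact/measurable_funB.
  - by apply: filterS fg => w fgw _; rewrite ger0_norm// subr_ge0.
by rewrite fine_ge0// integral_ge0// => w _; rewrite lee_fin.
Qed.

End real_integrals.

Section independent_increment.
Context {disp : measure_display} {T : measurableType disp} {R : realType}.
Variables (P : probability T R) (G : set (set T)).
Hypotheses (sG : sigma_algebra setT G) (GT : G `<=` measurable).
Variables (m : nat) (xi : T -> euclid R m).
Hypothesis mxi : measurable_fun setT xi.
Hypothesis Gxi : forall A B, G A -> measurable B ->
  (P (A `&` xi @^-1` B) = P A * P (xi @^-1` B))%E.

Local Notation TG := (g_sigma_algebraType G).
Local Notation intg f := (P.-integrable setT (EFin \o f)).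

Let measurable_id_sub : measurable_fun setT (id : T -> TG).
Proof.
move=> _ A mA; rewrite setTI; apply: GT.
by move: mA; rewrite /measurable/= sigma_algebra_id.
Qed.

Lemma sub_measurable_fun (f : TG -> R) :
  measurable_fun setT f -> measurable_fun setT (f : T -> R).
Proof. by move=> mf; exact: (measurableT_comp mf measurable_id_sub). Qed.

Let Gxi' (A : set TG) (B : set (euclid R m)) : measurable A -> measurable B ->
  (P ((id : T -> TG) @^-1` A `&` xi @^-1` B) =
   P ((id : T -> TG) @^-1` A) * P (xi @^-1` B))%E.
Proof. by rewrite /measurable/= sigma_algebra_id// => GA mB; exact: Gxi. Qed.

Lemma Rintegral_increment (f : TG -> R) (g : euclid R m -> R) :
  measurable_fun setT f -> measurable_fun setT g ->
  intg (f : T -> R) -> intg (g \o xi) ->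
  intg (fun w => f w * g (xi w)) /\
  \int[P]_w (f w * g (xi w)) = \int[P]_w f w * \int[P]_w g (xi w).
Proof.
move=> mf mg fi gi; split.
  exact: (integrable_indep measurable_id_sub mxi Gxi').
rewrite /Rintegral (integral_indep measurable_id_sub mxi Gxi')//.
by rewrite fineM//; exact: integrable_fin_num.
Qed.

Local Notation coord l := (fun x : euclid R m => (x : 'cV[R]_m) l 0).
Local Notation xi_ l w := ((xi w : 'cV[R]_m) l 0).

Hypothesis mcoord : forall l, measurable_fun setT (coord l).
Variable D : R.
Hypothesis xi_int : forall l, intg (fun w => xi_ l w).
Hypothesis xi_mean : forall l, \int[P]_w (xi_ l w) = 0.
Hypothesis xi_int2 : forall l l', intg (fun w => xi_ l w * xi_ l' w).
Hypothesis xi_var : forall l, \int[P]_w (xi_ l w * xi_ l w) <= D.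
Hypothesis xi_cov : forall l l', l != l' ->
  \int[P]_w (xi_ l w * xi_ l' w) = 0.

Lemma increment_row (z : TG -> R) (s : 'I_m -> TG -> R) :
  measurable_fun setT z -> (forall l, measurable_fun setT (s l)) ->
  intg (fun w : T => z w ^+ 2) -> (forall l, intg (fun w : T => s l w ^+ 2)) ->
  intg (fun w : T => (z w + \sum_l s l w * xi_ l w) ^+ 2) /\
  \int[P]_w ((z w + \sum_l s l w * xi_ l w) ^+ 2) <=
  \int[P]_w (z w ^+ 2) + D * \sum_l \int[P]_w (s l w ^+ 2).
Proof.
move=> mz ms iz is_.
pose x l (w : T) := xi_ l w.
have E w : (z w + \sum_l s l w * x l w) ^+ 2 =
    z w ^+ 2 + (2 * (\sum_l (z w * s l w) * x l w) +
    \sum_l \sum_l' (s l w * s l' w) * (x l w * x l' w)).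
  rewrite sqrrD -addrA; congr (_ + (_ + _)).
    rewrite -mulr_natl; congr (_ * _); rewrite mulr_sumr; apply: eq_bigr => l _.
    by rewrite mulrA.
  rewrite expr2 mulr_suml; apply: eq_bigr => l _.
  by rewrite mulr_sumr; apply: eq_bigr => l' _; rewrite mulrACA.
have H1 l : intg (fun w => (z w * s l w) * x l w) /\
    \int[P]_w ((z w * s l w) * x l w) = 0.
  have [|||? ->] := @Rintegral_increment (fun w => z w * s l w) _ _ (mcoord l).
  - exact: measurable_funM.
  - by apply: integrable_mul => //; exact: sub_measurable_fun.
  - exact: xi_int.
  - by split=> //; rewrite xi_mean mulr0.
have H2 l l' : intg (fun w => (s l w * s l' w) * (x l w * x l' w)) /\
    \int[P]_w ((s l w * s l' w) * (x l w * x l' w)) <=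
      if l == l' then D * \int[P]_w (s l w ^+ 2) else 0.
  have [|||? ->] := @Rintegral_increment (fun w => s l w * s l' w) _ _
    (measurable_funM (mcoord l) (mcoord l')).
  - exact: measurable_funM.
  - by apply: integrable_mul => //; exact: sub_measurable_fun.
  - exact: xi_int2.
  - split => //; case: eqVneq => [<-|ll']; last by rewrite xi_cov ?mulr0.
    rewrite mulrC.
    by apply: ler_wpM2r (xi_var l); apply: Rintegral_ge0 => w _; exact: sqr_ge0.
have I1 : intg (fun w => 2 * \sum_l (z w * s l w) * x l w).
  by apply/integrable_EFinZl/integrable_EFin_sum => l; have [] := H1 l.
have I2 : intg (fun w => \sum_l \sum_l' (s l w * s l' w) * (x l w * x l' w)).
  by do 2 apply/integrable_EFin_sum => ?; apply: (H2 _ _).1.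
have I3 := integrable_EFinD I1 I2.
split; first by under eq_fun do rewrite /= E; exact: integrable_EFinD.
under eq_Rintegral do rewrite E.
rewrite RintegralD// lerD2l RintegralD// RintegralZl//; last first.
  by apply/integrable_EFin_sum => l; have [] := H1 l.
rewrite Rintegral_sum; last by move=> l; have [] := H1 l.
rewrite [X in 2 * X]big1 ?mulr0 ?add0r; last by move=> l _; have [] := H1 l.
rewrite Rintegral_sum; last by move=> l; apply/integrable_EFin_sum => l';
  have [] := H2 l l'.
rewrite mulr_sumr; apply: ler_sum => l _.
rewrite Rintegral_sum; last by move=> l'; have [] := H2 l l'.
rewrite [leRHS](_ : _ = \sum_l' if l == l' then D * \int[P]_w (s l w ^+ 2) else 0).
  by apply: ler_sum => l' _; have [] := H2 l l'.
by rewrite -big_mkcond/= (eq_bigl (pred1 l)) ?big_pred1_eq// => l';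
  rewrite eq_sym.
Qed.
End independent_increment.

(** * Borel measurability of matrix-valued maps *)

Section matrix_measurability.
Context {R : realType} {p q : nat}.
Local Notation borel_mx := (g_sigma_algebraType (@open 'M[R]_(p, q))).

Lemma measurable_mx {disp : measure_display} {T : measurableType disp}
    (X : T -> 'M[R]_(p, q)) :
  (forall i j, measurable_fun setT (fun w => X w i j)) ->
  measurable_fun setT (X : T -> borel_mx).
Proof.
move=> mX; apply: (@measurability _ _ T borel_mx _ _ (@open 'M[R]_(p, q))) => //.
move=> _ [U oU <-]; rewrite setTI.
pose box (c : 'M[rat]_(p, q) * nat) : set T :=
  [set w | forall i j, `|ratr (c.1 i j) - X w i j| < c.2.+1%:R^-1].
pose good (c : 'M[rat]_(p, q) * nat) : Prop :=
  ball (map_mx ratr c.1 : 'M[R]_(p, q)) c.2.+1%:R^-1 `<=` U.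
have -> : X @^-1` U = \bigcup_(c in good) box c.
  apply/seteqP; split => [w|w [c cU boxw]]; last first.
    by apply: cU; split => // i j; rewrite mxE; exact: boxw.
  move=> /= Uw.
  have /nbhs_ballP[e /= e0 eU] : nbhs (X w) U by exact: open_nbhs_nbhs.
  have e20 : 0 < e / 2 by rewrite divr_gt0.
  have [n] := ltr_add_invr e20; rewrite add0r => ne.
  have /choice [r rX] : forall ij : 'I_p * 'I_q, exists r : rat,
      `|ratr r - X w ij.1 ij.2| < n.+1%:R^-1.
    move=> [i j] /=.
    have : X w i j - n.+1%:R^-1 < X w i j + n.+1%:R^-1 by rewrite ltrD2l gtrN.
    move=> /rat_in_itvoo[r].
    by rewrite in_itv/= -ltr_distl => ?; exists r.
  exists (\matrix_(i, j) r (i, j), n) => [|i j]; last first.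
    by rewrite mxE; exact: (rX (i, j)).
  move=> y [_ yq]; apply: eU; split => // i j.
  have := yq i j; have := rX (i, j); rewrite /ball/= !mxE => h1 h2.
  rewrite (_ : X w i j - y i j =
    - (ratr (r (i, j)) - X w i j) + (ratr (r (i, j)) - y i j)); last by ring.
  rewrite (le_lt_trans (ler_normD _ _))// normrN (splitr e) ltrD//.
    exact: lt_trans ne.
  exact: lt_trans ne.
rewrite bigcup_mkcond; apply: countable_bigcupT_measurable => // c.
case: ifP => _; last exact: measurable0.
rewrite (_ : box c = \bigcap_(ij in [set: 'I_p * 'I_q])
    [set w | `|ratr (c.1 ij.1 ij.2) - X w ij.1 ij.2| < c.2.+1%:R^-1]);
      last first.
  by apply/seteqP; split => [w bw [i j] _|w bw i j];
    [exact: bw|exact: (bw (i, j))].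
apply: fin_bigcap_measurable => // -[i j] _ /=.
have mh : measurable_fun setT (fun w => `|ratr (c.1 i j) - X w i j| : R).
  by apply: measurableT_comp => //; exact: measurable_funB.
have := mh measurableT _ (measurable_itv `]-oo, c.2.+1%:R^-1[); rewrite setTI.
by congr measurable; apply/seteqP; split => w /=; rewrite in_itv.
Qed.

End matrix_measurability.

Section continuous_measurable.
Context {R : realType} {p q : nat}.
Local Notation borel_mx := (g_sigma_algebraType (@open 'M[R]_(p, q))).

Lemma continuous_measurable_mx (f : 'M[R]_(p, q) -> R) : continuous f ->
  measurable_fun [set: borel_mx] (f : borel_mx -> R).
Proof.
move=> cf; apply: (measurability _ (RGenOpens.measurableE R)) => _ [_ [a [c ->] <-]].
rewrite setTI; apply: sub_sigma_algebra.
by apply: open_comp => [x _|]; [exact: cf|exact: interval_open].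
Qed.

Lemma measurable_coord_mx i j :
  measurable_fun [set: borel_mx] (fun x : borel_mx => (x : 'M[R]_(p, q)) i j).
Proof.
apply: (@continuous_measurable_mx (fun x => x i j)).
exact: coord_continuous.
Qed.

Lemma measurable_continuous_comp {disp : measure_display}
    {T : measurableType disp} (X : T -> 'M[R]_(p, q)) (f : 'M[R]_(p, q) -> R) :
  (forall i j, measurable_fun setT (fun w => X w i j)) -> continuous f ->
  measurable_fun setT (fun w => f (X w)).
Proof.
move=> mX cf.
exact: (measurableT_comp (continuous_measurable_mx cf) (measurable_mx mX)).
Qed.

End continuous_measurable.

Section frobenius.
Context {R : realType}.

Lemma fnorm_ge0 p q (A : 'M[R]_(p, q)) : 0 <= fnorm A.
Proof. exact: sqrtr_ge0. Qed.

Lemma fnorm_sqr p q (A : 'M[R]_(p, q)) :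
  fnorm A ^+ 2 = \sum_i \sum_j A i j ^+ 2.
Proof.
by rewrite sqr_sqrtr// sumr_ge0// => i _; rewrite sumr_ge0// => j _;
  rewrite sqr_ge0.
Qed.

Lemma fnorm_sqr_cV p (x : 'cV[R]_p) : fnorm x ^+ 2 = \sum_i x i 0 ^+ 2.
Proof. by rewrite fnorm_sqr; apply: eq_bigr => i _; rewrite big_ord1. Qed.

Lemma coord_sqr_le_fnorm p q (A : 'M[R]_(p, q)) i j : A i j ^+ 2 <= fnorm A ^+ 2.
Proof.
rewrite fnorm_sqr (bigD1 i)//= (bigD1 j)//= -addrA lerDl addr_ge0//.
  by rewrite sumr_ge0// => k _; rewrite sqr_ge0.
by rewrite sumr_ge0// => k _; rewrite sumr_ge0// => l _; rewrite sqr_ge0.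
Qed.

Lemma normr_coord_le_fnorm p q (A : 'M[R]_(p, q)) i j : `|A i j| <= fnorm A.
Proof.
by rewrite -(@ler_pXn2r _ 2) ?nnegrE ?fnorm_ge0// real_normK ?num_real// coord_sqr_le_fnorm.
Qed.

Lemma continuous_fnorm p q : continuous (@fnorm R p q).
Proof.
move=> A; apply: (@continuous_comp _ _ _
  (fun A : 'M[R]_(p, q) => \sum_i \sum_j A i j ^+ 2) Num.sqrt);
    last exact: sqrt_continuous.
apply: (continuous_big (op := +%R)) => [|i _]; first exact: add_continuous.
apply: (continuous_big (op := +%R)) => [|j _]; first exact: add_continuous.
move=> B; apply: (@continuous_comp _ _ _
  (fun A : 'M[R]_(p, q) => A i j) (fun x => x ^+ 2)).
  exact: coord_continuous.
exact: sqr_continuous.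
Qed.

End frobenius.

Section brownian_increment.
Context {R : realType} {disp : measure_display} {T : measurableType disp}.
Variables (P : probability T R) (F : R -> set (set T)).
Hypothesis UF : usual_conditions P F.
Variables (m : nat) (W : R -> T -> 'cV[R]_m) (BW : brownian_motion P F W).
Local Notation intg f := (P.-integrable setT (EFin \o f)).

Lemma filtration_sigma_algebra t : 0 <= t -> sigma_algebra setT (F t).
Proof. by case: UF => _ H _ _ _ /H[]. Qed.

Lemma filtration_measurable t : 0 <= t -> F t `<=` measurable.
Proof. by case: UF => _ H _ _ _ /H[]. Qed.

Lemma measurable_for_coord t p q (X : T -> 'M[R]_(p, q)) i j : 0 <= t ->
  measurable_for (F t) X ->
  measurable_fun setT (fun w : g_sigma_algebraType (F t) => X w i j).
Proof.
move=> t0 FX.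
apply: (@measurableT_comp _ _ _ _ _ _
  (fun x : g_sigma_algebraType (@open 'M[R]_(p, q)) => (x : 'M[R]_(p, q)) i j)).
  exact: measurable_coord_mx.
move=> _ B mB; rewrite setTI; apply: sub_sigma_algebra; exact: FX.
Qed.

Variables (s t : R) (s0 : 0 <= s) (st : s < t).
Let dW : T -> euclid R m := fun w => W t w - W s w.

Let mW u i : 0 <= u -> measurable_fun setT (fun w => W u w i 0).
Proof.
move=> u0; case: BW => _ _ FW _ _.
apply: (sub_measurable_fun (filtration_sigma_algebra u0) (filtration_measurable u0)).
by apply: measurable_for_coord => //; exact: FW.
Qed.

Let t0 : 0 <= t. Proof. exact: le_trans s0 (ltW st). Qed.

Let mdW_coord l : measurable_fun setT (fun w => (dW w : 'cV[R]_m) l 0).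
Proof.
rewrite (_ : (fun w => _) = fun w => W t w l 0 - W s w l 0).
  by apply: measurable_funB; exact: mW.
by apply/funext => w; rewrite !mxE.
Qed.

Let mdW : measurable_fun setT dW.
Proof.
by apply: measurable_mx => i j; rewrite (ord1 j); exact: mdW_coord.
Qed.

Let sd : R := Num.sqrt (t - s).

Let sd0 : sd != 0. Proof. by rewrite gt_eqF// sqrtr_gt0 subr_gt0. Qed.

Let sd2 : sd ^+ 2 = t - s.
Proof. by rewrite sqr_sqrtr// subr_ge0 ltW. Qed.

Let dW_law l A : measurable A ->
  P ((fun w => (dW w : 'cV[R]_m) l 0) @^-1` A) = normal_prob 0 sd A.
Proof.
move=> mA; case: BW => _ _ _ _ law.
have := @law s t (fun i => if i == l then A else setT) s0 st _.
rewrite (bigD1 l)//= eqxx big1 ?mule1 => [<-|i /negPf ->];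
  last exact: probability_setT.
- congr (P _); apply/seteqP; split => w /=.
    by move=> Aw i; case: eqVneq => [->|].
  by move=> /(_ l); rewrite eqxx.
- by move=> i; case: ifP.
Qed.

Let c l w := (dW w : 'cV[R]_m) l 0.

Let dW_law2 l l' (A B : set R) : l != l' -> measurable A -> measurable B ->
  (P (c l @^-1` A `&` c l' @^-1` B) = P (c l @^-1` A) * P (c l' @^-1` B))%E.
Proof.
move=> ll' mA mB; case: BW => _ _ _ _ law; rewrite !dW_law//.
have := @law s t
  (fun i => if i == l then A else if i == l' then B else setT) s0 st _.
have l'l : l' != l by rewrite eq_sym.
rewrite (bigD1 l)//= eqxx (bigD1 l')//= eqxx (negPf l'l).
rewrite big1 ?mule1 => [<-|i /andP[/negPf -> /negPf ->]];
  last exact: probability_setT.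
- congr (P _); apply/seteqP; split => w /=.
    by move=> [Aw Bw] i; case: eqVneq => [->//|_]; case: eqVneq => [->|].
  move=> H; split; first by have := H l; rewrite eqxx.
  by have := H l'; rewrite eqxx (negPf l'l).
- by move=> i; case: ifP => // _; case: ifP.
Qed.

Lemma brownian_step d (z : T -> 'cV[R]_d) (A : T -> 'M[R]_(d, m)) :
  (forall i,
    measurable_fun setT (fun w : g_sigma_algebraType (F s) => z w i 0)) ->
  (forall i j,
    measurable_fun setT (fun w : g_sigma_algebraType (F s) => A w i j)) ->
  intg (fun w => fnorm (z w) ^+ 2) -> intg (fun w => fnorm (A w) ^+ 2) ->
  intg (fun w => fnorm (z w + A w *m (W t w - W s w)) ^+ 2) /\
  \int[P]_w (fnorm (z w + A w *m (W t w - W s w)) ^+ 2) <=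
  \int[P]_w (fnorm (z w) ^+ 2) + (t - s) * \int[P]_w (fnorm (A w) ^+ 2).
Proof.
move=> mz mA iz iA.
have sF := filtration_sigma_algebra s0; have FT := filtration_measurable s0.
have mz' i : measurable_fun setT (fun w => z w i 0) :=
  sub_measurable_fun sF FT (mz i).
have mA' i j : measurable_fun setT (fun w => A w i j) :=
  sub_measurable_fun sF FT (mA i j).
have izi i : intg (fun w => z w i 0 ^+ 2).
  apply: integrable_le iz; first exact: measurable_funX.
  by move=> w; rewrite ger0_norm ?sqr_ge0// coord_sqr_le_fnorm.
have iAi i j : intg (fun w => A w i j ^+ 2).
  apply: integrable_le iA; first exact: measurable_funX.
  by move=> w; rewrite ger0_norm ?sqr_ge0// coord_sqr_le_fnorm.
have idW l := normal_integrable sd0 (mdW_coord l) (dW_law l).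
have idW2 l := normal_sqr_integrable sd0 (mdW_coord l) (dW_law l).
have ind (B : set T) (C : set (euclid R m)) : F s B -> measurable C ->
    (P (B `&` dW @^-1` C) = P B * P (dW @^-1` C))%E.
  by case: BW => _ _ _ H _ FB mC; exact: H.
have idWdW l l' : intg (fun w => c l w * c l' w).
  by apply: integrable_mul;
    [exact: mdW_coord|exact: mdW_coord|exact: idW2|exact: idW2].
have mean l : \int[P]_w c l w = 0.
  by rewrite /Rintegral (normal_mean0 sd0 (mdW_coord l) (dW_law l)).
have var l : \int[P]_w (c l w * c l w) <= t - s.
  rewrite -lee_fin fineK; last by apply: integrable_fin_num => //; exact: idWdW.
  rewrite -sd2; exact: (normal_moment2_le sd0 (mdW_coord l) (dW_law l)).
have cov l l' : l != l' -> \int[P]_w (c l w * c l' w) = 0.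
  move=> ll'; rewrite /Rintegral.
  rewrite (integral_indep (mdW_coord l) (mdW_coord l')
    (fun A B => dW_law2 ll') (f := id) (g := id))//; [|exact: idW|exact: idW].
  by rewrite (normal_mean0 sd0 (mdW_coord l) (dW_law l)) mul0e.
have row i := @increment_row _ T R P (F s) sF FT m dW mdW ind
  (fun l => measurable_coord_mx l 0) (t - s) idW mean idWdW var cov
  (fun w => z w i 0) (fun l w => A w i l) (mz i) (mA i) (izi i) (iAi i).
have E w : fnorm (z w + A w *m (W t w - W s w)) ^+ 2 =
    \sum_i (z w i 0 + \sum_l A w i l * c l w) ^+ 2.
  by rewrite fnorm_sqr_cV; apply: eq_bigr => i _; rewrite !mxE.
split.
  under eq_fun do rewrite /= E.
  by apply: integrable_EFin_sum => i; have [] := row i.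
under eq_Rintegral do rewrite E.
rewrite Rintegral_sum; last by move=> i; have [] := row i.
under [X in _ <= X + _]eq_Rintegral do rewrite fnorm_sqr_cV.
under [X in _ <= _ + _ * X]eq_Rintegral do rewrite fnorm_sqr.
rewrite Rintegral_sum// [X in _ <= _ + _ * X]Rintegral_sum; last first.
  by move=> i; apply: integrable_EFin_sum.
rewrite mulr_sumr -big_split/=; apply: ler_sum => i _.
by rewrite [X in _ <= _ + _ * X]Rintegral_sum//; have [] := row i.
Qed.
End brownian_increment.

(** * Empirical measures *)

Section empirical_measures.
Context {R : realType}.
Variables (N : nat) (N0 : (0 < N)%N).
Local Open Scope ereal_scope.

Lemma integral_empirical d (x : 'I_N -> euclid R d) (f : euclid R d -> \bar R) :
  measurable_fun setT f -> (forall y, 0 <= f y) ->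
  \int[empirical_measure N0 x]_y f y = (N%:R^-1)%:E * \sum_(i < N) f (x i).
Proof.
move=> mf f0.
pose D (n : nat) : {measure set (euclid R d) -> \bar R} :=
  \d_(x (insubd (Ordinal N0) n)).
have iN0 : (0 <= N%:R^-1 :> R)%R by rewrite invr_ge0.
pose invN : {nonneg R} := NngNum iN0.
rewrite (eq_measure_integral (mscale invN (msum D N))); last first.
  move=> A _ _; rewrite /= /empirical_measure /mscale /msum /=; congr (_ * _).
  by apply: eq_bigr => i _; rewrite -[in LHS](valKd (Ordinal N0) i).
rewrite ge0_integral_mscale// ge0_integral_measure_sum//.
congr (_ * _); apply: eq_bigr => i _.
by rewrite integral_dirac// diracT mul1e valKd.
Qed.

Lemma moment2_empirical d (x : 'I_N -> 'cV[R]_d) :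
  (moment2 (empirical N0 (x : 'I_N -> euclid R d)) ^+ 2 =
   N%:R^-1 * \sum_(i < N) fnorm (x i) ^+ 2)%R.
Proof.
rewrite /moment2 sqr_sqrtr; last first.
  by rewrite fine_ge0// integral_ge0// => y _; rewrite lee_fin sqr_ge0.
rewrite integral_empirical; last 2 first.
- exact: measurable_fnorm_sq.
- by move=> y; rewrite lee_fin sqr_ge0.
by rewrite sumEFin.
Qed.

Lemma wass2_empirical d (x y : 'I_N -> 'cV[R]_d) :
  (wass2 (empirical N0 (x : 'I_N -> euclid R d))
         (empirical N0 (y : 'I_N -> euclid R d)) ^+ 2
   <= N%:R^-1 * \sum_(i < N) fnorm (x i - y i) ^+ 2)%R.
Proof.
(* The coupling is the image of an empirical measure on R^(d+d). *)
pose xy i : euclid R (d + d) := col_mx (x i) (y i).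
pose f (z : euclid R (d + d)) : euclid R d * euclid R d :=
  (usubmx (z : 'cV[R]_(d + d)), dsubmx (z : 'cV[R]_(d + d))).
have mf1 : measurable_fun setT
    (fun z : euclid R (d + d) => (usubmx (z : 'cV[R]_(d + d))) : euclid R d).
  apply: measurable_mx => i j.
  rewrite (_ : (fun w => _) =
    fun w : euclid R (d + d) => (w : 'cV[R]_(d + d)) (lshift d i) j).
    exact: measurable_coord_mx.
  by apply/funext => w; rewrite mxE.
have mf2 : measurable_fun setT
    (fun z : euclid R (d + d) => (dsubmx (z : 'cV[R]_(d + d))) : euclid R d).
  apply: measurable_mx => i j.
  rewrite (_ : (fun w => _) =
    fun w : euclid R (d + d) => (w : 'cV[R]_(d + d)) (rshift d i) j).
    exact: measurable_coord_mx.
  by apply/funext => w; rewrite mxE.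
have mf : measurable_fun setT f by exact: measurable_fun_pair.
pose f' : {mfun euclid R (d + d) >-> (euclid R d * euclid R d)%type} :=
  HB.pack f (isMeasurableFun.Build _ _ _ _ _ mf).
pose pi : probability (euclid R d * euclid R d)%type R :=
  distribution (empirical_measure N0 xy) f'.
have cpi : coupling (empirical N0 (x : 'I_N -> euclid R d))
    (empirical N0 (y : 'I_N -> euclid R d)) pi.
  move=> A mA; rewrite /pi /distribution /pushforward /= /empirical_measure.
  split; congr (_ * _).
    apply: eq_bigr => i _; rewrite !diracE; congr ((_ : bool)%:R%:E).
    by apply/idP/idP; rewrite !inE/= /xy col_mxKu// => -[].
  apply: eq_bigr => i _; rewrite !diracE; congr ((_ : bool)%:R%:E).
  by apply/idP/idP; rewrite !inE/= /xy col_mxKd// => -[].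
have piE : \int[pi]_z (fnorm (z.1 - z.2 : 'cV[R]_d) ^+ 2)%:E =
    (N%:R^-1 * \sum_(i < N) fnorm (x i - y i) ^+ 2)%:E.
  have mg : measurable_fun setT
      (fun z : euclid R d * euclid R d => (fnorm (z.1 - z.2 : 'cV[R]_d) ^+ 2)%:E).
    apply/measurable_EFinP/measurable_funX.
    apply: (@measurable_continuous_comp _ _ _ _ _
      (fun z : euclid R d * euclid R d => z.1 - z.2 : 'cV[R]_d)%R).
      move=> i j; rewrite (_ : (fun w => _) = fun w : euclid R d * euclid R d =>
        ((w.1 : 'cV[R]_d) i j - (w.2 : 'cV[R]_d) i j)%R);
        last by apply/funext => w; rewrite !mxE.
      apply: measurable_funB.
        exact: (measurableT_comp (measurable_coord_mx i j) measurable_fst).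
      exact: (measurableT_comp (measurable_coord_mx i j) measurable_snd).
    exact: continuous_fnorm.
  rewrite ge0_integral_distribution//; last by move=> z;
    rewrite lee_fin sqr_ge0.
  rewrite integral_empirical/=; last 2 first.
  - exact: (measurableT_comp mg mf).
  - by move=> z; rewrite lee_fin sqr_ge0.
  by rewrite sumEFin; congr EFin; congr (_ * _)%R; apply: eq_bigr => i _;
    rewrite col_mxKu col_mxKd.
rewrite /wass2; set S := [set _ | _ in _].
have S0 : 0 <= ereal_inf S.
  by apply: le_ereal_inf_tmp => _ [rho _ <-]; apply: integral_ge0 => z _;
    rewrite lee_fin sqr_ge0.
have Sle : ereal_inf S <= (N%:R^-1 * \sum_(i < N) fnorm (x i - y i) ^+ 2)%:E.
  by rewrite -piE; apply: ereal_inf_lbound; exists pi.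
rewrite sqr_sqrtr ?fine_ge0// -lee_fin fineK// ge0_fin_numE//.
by rewrite (le_lt_trans Sle)// ltry.
Qed.

End empirical_measures.

Lemma continuous_at_dist_le {R : realType} {T : topologicalType}
    (f g : T -> R) (x : T) :
  {for x, continuous g} -> g x = 0 ->
  (\forall y \near x, `|f y - f x| <= g y) -> {for x, continuous f}.
Proof.
move=> cg g0 fg; apply/cvgrPdist_lt => e e0.
have /cvgrPdist_lt/(_ _ e0) := cg; rewrite g0 => ge.
near=> y; rewrite distrC (@le_lt_trans _ _ (g y))//; first by near: y.
have : `|0 - g y| < e by near: y.
by rewrite sub0r normrN; apply: le_lt_trans; exact: ler_norm.
Unshelve. all: by end_near. Qed.

Section diffusion_continuity.
Context {R : realType} {d m : nat}.
Variables (b : 'cV[R]_d -> prob2 R d -> 'cV[R]_d)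
  (sigma : 'cV[R]_d -> prob2 R d -> 'M[R]_(d, m))
  (sigma1 : 'cV[R]_d -> 'M[R]_(d, m)) (sigma2 : prob2 R d -> 'M[R]_(d, m)).
Hypothesis sigma_split : forall x mu, sigma x mu = sigma1 x + sigma2 mu.

Lemma sigma1_coord_continuous i j : loc_lipschitz sigma ->
  continuous (fun x => sigma1 x i j).
Proof.
move=> lip x.
have [L xL] := lip (empirical (ltn0Sn 0) (fun=> 0)) (fnorm x + 1).
apply: (@continuous_at_dist_le R 'cV[R]_d (fun y => sigma1 y i j)
  (fun y => L * fnorm (y - x))).
- apply: continuousM; first exact: cst_continuous.
  apply: (@continuous_comp 'cV[R]_d 'cV[R]_d R (fun y => y - x) (@fnorm R d 1)).
    by apply: continuousB; [exact: cvg_id|exact: cst_continuous].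
  exact: continuous_fnorm.
- rewrite subrr /fnorm big1 ?sqrtr0 ?mulr0// => k _; rewrite big1// => l _.
  by rewrite mxE expr0n.
near=> y.
have := xL y x; rewrite !sigma_split opprD addrACA subrr addr0 => /(_ _ _)/le_trans.
rewrite (_ : sigma1 y i j - sigma1 x i j = (sigma1 y - sigma1 x) i j);
  last by rewrite !mxE.
move=> H; apply: le_trans (normr_coord_le_fnorm _ _ _) _; apply: H => //.
- near: y; have := @continuous_fnorm R d 1 x.
  move=> /cvgr_le; apply.
  by rewrite ltrDl.
- by rewrite lerDl.
Unshelve. all: by end_near. Qed.

Variables (K1 K2 : R) (K2_gt0 : 0 < K2).
Hypothesis cond_i : forall (x y : 'cV[R]_d) (mu nu : prob2 R d),
  2 * dotp (x - y) (b x mu - b y nu) + fnorm (sigma x mu - sigma y nu) ^+ 2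
    <= - K1 * fnorm (x - y) ^+ 2 + K2 * wass2 mu nu ^+ 2.

Lemma sigma2_lipschitz mu nu :
  fnorm (sigma2 mu - sigma2 nu) ^+ 2 <= K2 * wass2 mu nu ^+ 2.
Proof.
have := cond_i 0 0 mu nu; rewrite !sigma_split subrr.
rewrite (_ : dotp 0 _ = 0); last by rewrite /dotp big1// => i _;
  rewrite mxE mul0r.
rewrite (_ : fnorm 0 ^+ 2 = 0) ?mulr0 ?add0r; last first.
  by rewrite fnorm_sqr_cV big1// => i _; rewrite mxE expr0n.
by rewrite opprD addrACA subrr add0r.
Qed.

Lemma sigma2_empirical_continuous (N : nat) (N0 : (0 < N)%N) i j :
  continuous (fun M : 'M[R]_(d, N) => sigma2 (empirical N0 (fun n => col n M)) i j).
Proof.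
move=> M.
pose h (M' : 'M[R]_(d, N)) := K2 * (N%:R^-1 * \sum_n \sum_k (M' k n - M k n) ^+ 2).
apply: (@continuous_at_dist_le R 'M[R]_(d, N) _ (fun M' => Num.sqrt (h M'))).
- apply: (@continuous_comp 'M[R]_(d, N) R R h Num.sqrt);
    last exact: sqrt_continuous.
  apply: continuousM; first exact: cst_continuous.
  apply: continuousM; first exact: cst_continuous.
  apply: (continuous_big (op := +%R)) => [|n _]; first exact: add_continuous.
  apply: (continuous_big (op := +%R)) => [|k _]; first exact: add_continuous.
  move=> B; apply: (@continuous_comp 'M[R]_(d, N) R R
    (fun A => A k n - M k n) (fun x => x ^+ 2)).
    by apply: continuousB; [exact: coord_continuous|exact: cst_continuous].
  exact: sqr_continuous.
- rewrite /h big1 ?mulr0 ?sqrtr0// => n _; rewrite big1// => k _.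
  by rewrite subrr expr0n.
near=> M'.
rewrite -[leLHS]sqrtr_sqr ler_wsqrtr//.
set mu' := empirical N0 _; set mu := empirical N0 _.
rewrite (_ : sigma2 mu' i j - sigma2 mu i j = (sigma2 mu' - sigma2 mu) i j);
  last by rewrite !mxE.
apply: le_trans (coord_sqr_le_fnorm _ _ _) _;
  apply: le_trans (sigma2_lipschitz _ _) _.
rewrite ler_pM2l//; apply: le_trans (wass2_empirical _ _ _) _.
rewrite ler_wpM2l ?invr_ge0//; apply: ler_sum => n _.
by rewrite fnorm_sqr_cV; apply: ler_sum => k _; rewrite !mxE.
Unshelve. all: by end_near. Qed.

End diffusion_continuity.

(** * One step of the scheme *)

Section fnorm_algebra.
Context {R : realType}.

Lemma fnorm_lincomb d (u v : R) (x y : 'cV[R]_d) :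
  fnorm (u *: x + v *: y) ^+ 2 =
  u ^+ 2 * fnorm x ^+ 2 + 2 * u * v * dotp x y + v ^+ 2 * fnorm y ^+ 2.
Proof.
rewrite !fnorm_sqr_cV /dotp !mulr_sumr -!big_split/=.
by apply: eq_bigr => i _; rewrite !mxE; ring.
Qed.

Lemma fnorm_sqrD_le p q (A B : 'M[R]_(p, q)) :
  fnorm (A + B) ^+ 2 <= 2 * fnorm A ^+ 2 + 2 * fnorm B ^+ 2.
Proof.
rewrite !fnorm_sqr !mulr_sumr -big_split/=; apply: ler_sum => i _.
rewrite !mulr_sumr -big_split/=; apply: ler_sum => j _.
rewrite mxE -subr_ge0 (_ : _ - _ = (A i j - B i j) ^+ 2) ?sqr_ge0//; ring.
Qed.

(* With [c = 0] one just drops [D^2 |y|^2].  Keeping part of it through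
   [0 <= |c x + D y|^2] puts the factor [1 + c > 1] in front of [S], which is what
   makes the contribution of the diffusion decay when [p0 = 3]. *)
Lemma implicit_step_ge d (x y : 'cV[R]_d) (D c l1 l2 p0 S M : R) :
  0 <= D -> 0 <= c -> 3 <= p0 -> 0 <= S ->
  2 * dotp x y + (p0 - 1) * S <= - l1 * fnorm x ^+ 2 + l2 * M ->
  (1 - c ^+ 2 + D * (1 + c) * l1) * fnorm x ^+ 2 + 2 * D * (1 + c) * S
    <= fnorm (x - D *: y) ^+ 2 + D * (1 + c) * l2 * M.
Proof.
move=> D0 c0 p03 S0 H.
have := sqr_ge0 (fnorm (c *: x + D *: y)).
rewrite fnorm_lincomb -[x - _](_ : 1 *: x + (- D) *: y = _);
  last by rewrite scale1r scaleNr.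
rewrite fnorm_lincomb.
have : 0 <= D * (1 + c) * (- l1 * fnorm x ^+ 2 + l2 * M - 2 * dotp x y - 2 * S).
  apply: mulr_ge0; first by apply: mulr_ge0 => //; exact: addr_ge0.
  have : 2 * S <= (p0 - 1) * S by rewrite ler_wpM2r//; lra.
  by move: H; lra.
by lra.
Qed.

End fnorm_algebra.

Section recursion.
Context {R : realType} {d m : nat}.
Variables (b : 'cV[R]_d -> prob2 R d -> 'cV[R]_d)
  (sigma : 'cV[R]_d -> prob2 R d -> 'M[R]_(d, m))
  (sigma1 : 'cV[R]_d -> 'M[R]_(d, m)) (sigma2 : prob2 R d -> 'M[R]_(d, m))
  (sigma_split : forall x mu, sigma x mu = sigma1 x + sigma2 mu).
Variables (l1 l2 d2 p0 : R) (p0_ge3 : 3 <= p0).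
Hypothesis cond_iii : forall (x : 'cV[R]_d) (mu : prob2 R d),
   2 * dotp x (b x mu) + (p0 - 1) * fnorm (sigma1 x) ^+ 2
     <= - l1 * fnorm x ^+ 2 + l2 * moment2 mu ^+ 2.
Hypothesis sigma2_bound : forall mu : prob2 R d,
   fnorm (sigma2 mu) ^+ 2 <= d2 * moment2 mu ^+ 2.
Variables (N : nat) (N0 : (0 < N)%N).
Hypothesis sigma1_cont : forall i j, continuous (fun x => sigma1 x i j).
Hypothesis sigma2_cont : forall i j,
  continuous (fun M : 'M[R]_(d, N) => sigma2 (empirical N0 (fun n => col n M)) i j).

Context {disp : measure_display} {T : measurableType disp}.
Variables (P : probability T R) (F : R -> set (set T)) (UF : usual_conditions P F).
Variables (Xj : 'I_N -> T -> 'cV[R]_d) (Wj : 'I_N -> R -> T -> 'cV[R]_m).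
Hypothesis BW : forall j, brownian_motion P F (Wj j).
Variables (D : R) (D_gt0 : 0 < D) (Z : nat -> 'I_N -> T -> 'cV[R]_d).
Hypothesis bem : backward_euler P F b sigma N0 Xj Wj D Z.
Local Notation intg f := (P.-integrable setT (EFin \o f)).

Variables (c : R) (c_ge0 : 0 <= c).
Let A := 1 - c ^+ 2 + D * (1 + c) * l1.
Let B := 2 * D * (1 + c).
Hypothesis A_gt0 : 0 < A.

Let B_gt0 : 0 < B. Proof. by rewrite !mulr_gt0// ltr_wpDr. Qed.

Let a k j := \int[P]_w (fnorm (Z k j w) ^+ 2).
Let s k j := \int[P]_w (fnorm (sigma1 (Z k j w)) ^+ 2).

Let kD_ge0 k : 0 <= k%:R * D. Proof. by rewrite mulr_ge0// ltW. Qed.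

Local Notation TF k := (g_sigma_algebraType (F (k%:R * D))).

Let mZ_filtration k j i : measurable_fun setT (fun w : TF k => Z k j w i 0).
Proof. by apply: measurable_for_coord => //; case: bem. Qed.

Let mZ k j i : measurable_fun setT (fun w => Z k j w i 0).
Proof.
apply: (sub_measurable_fun (filtration_sigma_algebra UF (kD_ge0 k))
  (filtration_measurable UF (kD_ge0 k))).
exact: mZ_filtration.
Qed.

Lemma measurable_scheme_sqr k j :
  measurable_fun setT (fun w => fnorm (Z k j w) ^+ 2).
Proof.
apply: measurable_funX; apply: (measurable_continuous_comp (X := Z k j)).
  by move=> i l; rewrite (ord1 l).
exact: continuous_fnorm.
Qed.

Lemma measurable_diffusion_sqr k j :
  measurable_fun setT (fun w => fnorm (sigma1 (Z k j w)) ^+ 2).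
Proof.
apply: measurable_funX.
apply: (measurable_continuous_comp (X := fun w => sigma1 (Z k j w))).
  move=> i l; apply: (measurable_continuous_comp (X := Z k j)
    (f := fun x => sigma1 x i l)) => //.
  by move=> i' l'; rewrite (ord1 l').
exact: continuous_fnorm.
Qed.

Let mu k w := empirical N0 (fun i => Z k i w : euclid R d).

Let mean2 k w := N%:R^-1 * \sum_i fnorm (Z k i w) ^+ 2.

Let moment2_mu k w : moment2 (mu k w) ^+ 2 = mean2 k w.
Proof. exact: moment2_empirical. Qed.

Let msigma k j i l : measurable_fun setT
  (fun w : TF k => sigma (Z k j w) (mu k w) i l).
Proof.
rewrite (_ : (fun w => _) =
    (fun w => sigma1 (Z k j w) i l + sigma2 (mu k w) i l)); last first.
  by apply/funext => w; rewrite sigma_split mxE.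
apply: measurable_funD.
  apply: (measurable_continuous_comp (T := TF k) (X := Z k j)
    (f := fun x => sigma1 x i l)) => //.
  by move=> i' l'; rewrite (ord1 l').
pose X (w : TF k) : 'M[R]_(d, N) := \matrix_(i, n) Z k n w i 0.
rewrite (_ : (fun w => _) =
    (fun w => sigma2 (empirical N0 (fun n => col n (X w))) i l)); last first.
  apply/funext => w; congr (sigma2 (empirical _ _) _ _).
  by apply/funext => n; apply/matrixP => p q; rewrite !mxE (ord1 q).
apply: (measurable_continuous_comp (X := X)
  (f := fun M => sigma2 (empirical N0 (fun n => col n M)) i l)) => //.
move=> p n; rewrite (_ : (fun w => _) = (fun w => Z k n w p 0)) //.
by apply/funext => w; rewrite mxE.
Qed.

Lemma scheme_step k :
  (forall j, intg (fun w => fnorm (Z k j w) ^+ 2)) ->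
  (forall j, intg (fun w => fnorm (sigma1 (Z k j w)) ^+ 2)) ->
  forall j, [/\ intg (fun w => fnorm (Z k.+1 j w) ^+ 2),
    intg (fun w => fnorm (sigma1 (Z k.+1 j w)) ^+ 2) &
    A * a k.+1 j + B * s k.+1 j <= a k j + 2 * D * s k j +
      (2 * D * d2 + D * (1 + c) * l2) * (N%:R^-1 * \sum_i a k i)].
Proof.
move=> iZ iS j.
have iM : intg (mean2 k) by apply/integrable_EFinZl/integrable_EFin_sum.
have EM : \int[P]_w mean2 k w = N%:R^-1 * \sum_i a k i.
  rewrite /mean2 RintegralZl//; last exact: integrable_EFin_sum.
  by rewrite Rintegral_sum.
have sle w : fnorm (sigma (Z k j w) (mu k w)) ^+ 2 <=
    2 * fnorm (sigma1 (Z k j w)) ^+ 2 + 2 * d2 * mean2 k w.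
  rewrite sigma_split (le_trans (fnorm_sqrD_le _ _))// lerD2l -mulrA ler_pM2l//.
  by rewrite -moment2_mu.
have isle : intg (fun w => 2 * fnorm (sigma1 (Z k j w)) ^+ 2 + 2 * d2 * mean2 k w).
  by apply: integrable_EFinD; exact: integrable_EFinZl.
have msigma2 : measurable_fun setT
    (fun w => fnorm (sigma (Z k j w) (mu k w)) ^+ 2).
  apply: measurable_funX; apply: (measurable_continuous_comp
    (X := fun w => sigma (Z k j w) (mu k w))); last exact: continuous_fnorm.
  move=> i l.
  by apply: (sub_measurable_fun (filtration_sigma_algebra UF (kD_ge0 k))
    (filtration_measurable UF (kD_ge0 k))).
have [is_ Es] := ae_le_integrable msigma2 (fun w => sqr_ge0 _) isle (aeW P sle).
have kD : k%:R * D < k.+1%:R * D by rewrite ltr_pM2r// ltr_nat.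
have [iY] := brownian_step UF (BW j) (kD_ge0 k) kD (@mZ_filtration k j)
  (@msigma k j) (iZ j) is_.
rewrite -mulrBl -natrB// subSn// subnn mul1r => EY.
pose f w := A * fnorm (Z k.+1 j w) ^+ 2 + B * fnorm (sigma1 (Z k.+1 j w)) ^+ 2.
pose y w := Z k j w + sigma (Z k j w) (mu k w) *m
  (Wj j (k.+1%:R * D) w - Wj j (k%:R * D) w).
pose g w := fnorm (y w) ^+ 2 + D * (1 + c) * l2 * mean2 k w.
have ig : intg g by apply: integrable_EFinD => //; exact: integrable_EFinZl.
have mf : measurable_fun setT f.
  apply: measurable_funD; apply: measurable_funM => //.
    exact: measurable_scheme_sqr.
  exact: measurable_diffusion_sqr.
have f0 w : 0 <= f w by rewrite addr_ge0// mulr_ge0 ?sqr_ge0// ltW.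
have fg : {ae P, forall w, f w <= g w}.
  case: bem => _ _ /(_ k j); apply: filterS => w E.
  rewrite /f /g (_ : y w = Z k.+1 j w - D *: b (Z k.+1 j w) (mu k w));
    last first.
    by apply/esym/eqP; rewrite subr_eq; apply/eqP; rewrite [LHS]E /y addrAC.
  rewrite -moment2_mu; apply: implicit_step_ge (cond_iii _ _) => //;
    first exact: ltW.
  exact: sqr_ge0.
have [if_ Ef] := ae_le_integrable mf f0 ig fg.
have iZ' : intg (fun w => fnorm (Z k.+1 j w) ^+ 2).
  apply: integrable_le (integrable_EFinZl A^-1 if_);
    first exact: measurable_scheme_sqr.
  move=> w; rewrite ger0_norm ?sqr_ge0// ler_pdivlMl// lerDl.
  by rewrite mulr_ge0 ?sqr_ge0// ltW.
have iS' : intg (fun w => fnorm (sigma1 (Z k.+1 j w)) ^+ 2).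
  apply: integrable_le (integrable_EFinZl B^-1 if_);
    first exact: measurable_diffusion_sqr.
  move=> w; rewrite ger0_norm ?sqr_ge0// ler_pdivlMl// lerDr.
  by rewrite mulr_ge0 ?sqr_ge0// ltW.
split => //.
move: Ef; rewrite /f RintegralD//; try exact: integrable_EFinZl.
rewrite !RintegralZl// => /le_trans; apply.
rewrite /g RintegralD//; last exact: integrable_EFinZl.
rewrite RintegralZl// [X in _ + _ * X <= _](_ : _ = N%:R^-1 * \sum_i a k i);
  last exact: EM.
have {}Es : \int[P]_w (fnorm (sigma (Z k j w) (mu k w)) ^+ 2) <=
    2 * s k j + 2 * d2 * (N%:R^-1 * \sum_i a k i).
  apply: (le_trans Es); rewrite RintegralD//; try exact: integrable_EFinZl.
  rewrite RintegralZl// RintegralZl// le_eqVlt; apply/orP; left; apply/eqP.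
  by congr (_ + _ * _); exact: EM.
have := ler_wpM2l (ltW D_gt0) Es.
by move: EY; rewrite /a /s /y; lra.
Qed.

Hypothesis Z0_int : forall j, intg (fun w => fnorm (Z 0%N j w) ^+ 2).
Hypothesis S0_int : forall j, intg (fun w => fnorm (sigma1 (Z 0%N j w)) ^+ 2).

Lemma scheme_integrable k j : intg (fun w => fnorm (Z k j w) ^+ 2) /\
  intg (fun w => fnorm (sigma1 (Z k j w)) ^+ 2).
Proof.
elim: k j => [|k IHk] j; first by split; [exact: Z0_int|exact: S0_int].
by have [||] := @scheme_step k _ _ j => // i; have [] := IHk i.
Qed.

Variable q : R.
Hypothesis qA : 1 + 2 * D * d2 + D * (1 + c) * l2 <= q * A.
Hypothesis qB : 2 * D <= q * B.

Let q_ge0 : 0 <= q.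
Proof.
have : 0 < q * B by apply: lt_le_trans qB; rewrite mulr_gt0.
by rewrite pmulr_lgt0// => /ltW.
Qed.

Let a_ge0 k j : 0 <= a k j.
Proof. by apply: Rintegral_ge0 => w _; exact: sqr_ge0. Qed.

Let s_ge0 k j : 0 <= s k j.
Proof. by apply: Rintegral_ge0 => w _; exact: sqr_ge0. Qed.

Let V k := \sum_j (A * a k j + B * s k j).

Let V_decay k : V k.+1 <= q * V k.
Proof.
pose M := N%:R^-1 * \sum_i a k i.
have -> : q * V k = \sum_j (q * (A * a k j + B * s k j)) by rewrite mulr_sumr.
apply: (@le_trans _ _ (\sum_j (a k j + 2 * D * s k j +
    (2 * D * d2 + D * (1 + c) * l2) * M))).
  apply: ler_sum => j _.
  by have [||] := @scheme_step k _ _ j => // i;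
    have [] := scheme_integrable k i.
rewrite big_split/= sumr_const card_ord -mulrnAr.
have -> : M *+ N = \sum_i a k i.
  by rewrite -mulr_natl mulrA divff ?mul1r// pnatr_eq0 -lt0n.
rewrite mulr_sumr -big_split/=; apply: ler_sum => j _.
have := ler_wpM2r (a_ge0 k j) qA; have := ler_wpM2r (s_ge0 k j) qB.
by lra.
Qed.

Lemma scheme_decay k j :
  \int[P]_w (fnorm (Z k j w) ^+ 2) <= A^-1 * V 0%N * q ^+ k.
Proof.
have VV : V k <= V 0%N * q ^+ k.
  elim: k => [|k IHk]; first by rewrite expr0 mulr1.
  rewrite (le_trans (V_decay k))// exprS mulrCA ler_wpM2l//.
rewrite -mulrA ler_pdivlMl// (le_trans _ VV)// /V (bigD1 j)//=.
rewrite -addrA lerDl; apply: addr_ge0; first by rewrite mulr_ge0 ?(ltW B_gt0).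
by apply: sumr_ge0 => i _; rewrite addr_ge0// mulr_ge0// ltW.
Qed.

End recursion.

Section same_law_integrability.
Context {R : realType} {disp : measure_display} {T : measurableType disp}.
Variable P : probability T R.
Context {d m : nat}.
Variables (X X' : T -> euclid R d) (W W' : R -> T -> 'cV[R]_m).
Hypotheses (mX : measurable_fun setT X) (mX' : measurable_fun setT X').
Hypothesis law : same_law P X' W' X W.

Lemma same_law_integrable (f : euclid R d -> R) :
  measurable_fun setT f -> (forall x, 0 <= f x) ->
  P.-integrable setT (EFin \o (f \o X)) ->
  P.-integrable setT (EFin \o (f \o X')).
Proof.
move=> mf f0 /integrableP[_ fX]; apply/integrableP; split.
  by apply/measurable_EFinP; exact: measurableT_comp.
have absE (U : T -> euclid R d) :
    (\int[P]_w `|(EFin \o (f \o U)) w| = \int[P]_w (f (U w))%:E)%E.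
  by apply: eq_integral => w _; rewrite /= ger0_norm.
move: fX; rewrite !absE => fX.
pose Y : {mfun T >-> euclid R d} := HB.pack X (isMeasurableFun.Build _ _ _ _ _ mX).
pose Y' : {mfun T >-> euclid R d} := HB.pack X' (isMeasurableFun.Build _ _ _ _ _ mX').
have mEf : measurable_fun setT (EFin \o f) by exact/measurable_EFinP.
move: fX; rewrite -(@ge0_integral_distribution _ _ _ _ _ P Y (EFin \o f))//.
rewrite -(@ge0_integral_distribution _ _ _ _ _ P Y' (EFin \o f))//.
rewrite (eq_measure_integral (distribution P Y'))// => A mA _.
have setE (U : T -> euclid R d) (V : R -> T -> 'cV[R]_m) :
    [set w | A (U w) /\ forall i : 'I_0, [set: 'cV[R]_m] (V 0 w)] = U @^-1` A.
  by apply/seteqP; split => [w [] //|w Aw]; split.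
have := @law 0%N (fun=> 0) A (fun=> setT) (fun i => lexx 0) mA.
rewrite !setE => H.
have {}H : P (X' @^-1` A) = P (X @^-1` A) by apply: H => -[].
exact/esym.
Qed.

End same_law_integrability.

Section log_growth.
Context {R : realType}.

Lemma le_limn_esup (u v : (\bar R)^nat) :
  (\forall n \near \oo, (u n <= v n)%E) -> (limn_esup u <= limn_esup v)%E.
Proof.
move=> [n0 _ uv]; rewrite !limn_esup_lim.
apply: lee_lim; [exact: is_cvg_esups|exact: is_cvg_esups|].
exists n0 => // n /= n0n; apply: ge_ereal_sup => _ [k /= nk <-].
apply: le_trans (uv k (leq_trans n0n nk)) _.
by apply: ereal_sup_ubound; exists k.
Qed.

Lemma limn_esup_lne_le (e : R^nat) (C alpha D : R) : (0 < D)%R ->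
  (forall k, (e k <= C * expR (- (alpha * D)) ^+ k)%R) ->
  (limn_esup (fun k : nat => ((k%:R * D)^-1)%:E * lne (e k)%:E)
   <= (- alpha)%:E)%E.
Proof.
move=> D0 eC; pose C' := Num.max C 1%R.
have C'0 : (0 < C')%R by rewrite lt_max ltr01 orbT.
pose v k := ((k%:R * D)^-1 * ln C' - alpha)%R.
have vE : (fun k => (v k)%:E) @ \oo --> (- alpha)%:E.
  apply: cvg_EFin; first exact: nearW.
  suff : v k @[k --> \oo] --> - alpha by [].
  rewrite -[X in _ --> X]add0r; apply: cvgB; last exact: cvg_cst.
  rewrite -(mul0r (ln C')); apply: cvgM; last exact: cvg_cst.
  rewrite (_ : (fun k : nat => (k%:R * D)^-1) = (fun k => k%:R^-1 * D^-1));
    last first.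
    by apply/funext => k; rewrite invfM.
  rewrite -(mul0r D^-1); apply: cvgM; last exact: cvg_cst.
  apply/gtr0_cvgV0; last exact: cvgr_idn.
  by exists 1%N => // k /= k0; rewrite ltr0n.
rewrite -(cvg_limn_einf_sup vE).2; apply: le_limn_esup.
exists 1%N => // k /= k0.
have kD0 : (0 < k%:R * D)%R by rewrite mulr_gt0// ltr0n.
have [e0|e0] := leP (e k) 0%R.
  rewrite gt0_muleNy ?lte_fin ?invr_gt0//; exact: leNye.
rewrite -EFinM lee_fin /v -ler_pdivlMl ?invr_gt0// invrK mulrBr mulrA.
rewrite mulfV ?gt_eqF// mul1r.
have : (ln (e k) <= ln (C' * expR (- (alpha * D)) ^+ k))%R.
  rewrite ler_ln ?posrE// ?mulr_gt0 ?exprn_gt0 ?expR_gt0//.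
  by apply: le_trans (eC k) _; rewrite ler_wpM2r ?exprn_ge0 ?expR_ge0// le_max lexx.
rewrite lnM ?posrE ?exprn_gt0 ?expR_gt0// lnXn ?expR_gt0// expRK -mulr_natl.
move=> /le_trans; apply; rewrite le_eqVlt; apply/orP; left; apply/eqP; ring.
Qed.
End log_growth.

(** * The decay rate *)

Section decay_rate.
Context {R : realType}.
Variables (l1 l2 d2 : R).
Hypotheses (l1_gt0 : 0 < l1) (d2_gt0 : 0 < d2).
Let lam := l1 - l2 - 2 * d2.
Hypothesis lam_gt0 : 0 < lam.

Let quarter_root (D : R) : R := Num.sqrt (Num.sqrt D).

Let kappa : R := Num.min 2^-1 (lam / 2).

(* [D << c << D^(1/2)] as [D --> 0]. *)
Let c (e : R) : R := kappa * e ^+ 3.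

Let rate1 (e : R) : R :=
  (lam + c e * (l1 - l2) - kappa ^+ 2 * e ^+ 2) /
  (1 - c e ^+ 2 + e ^+ 4 * (1 + c e) * l1).

Let rate2 (e : R) : R := kappa / (e * (1 + c e)).

Let alpha (D : R) : R :=
  Num.min (rate1 (quarter_root D)) (rate2 (quarter_root D)).

Let kappa_gt0 : 0 < kappa.
Proof. by rewrite lt_min invr_gt0 ltr0n/= divr_gt0. Qed.

Let kappa_le : kappa <= 2^-1. Proof. by rewrite ge_min lexx. Qed.

Let kappa2_lt : kappa ^+ 2 < lam.
Proof.
have : kappa <= lam / 2 by rewrite ge_min lexx orbT.
by move: kappa_gt0 kappa_le lam_gt0; nra.
Qed.

Let quarter_root4 D : 0 < D -> quarter_root D ^+ 4 = D.
Proof.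
move=> D0; rewrite -[4%N]/(2 * 2)%N exprM sqr_sqrtr ?sqrtr_ge0//.
by rewrite sqr_sqrtr// ltW.
Qed.

Let quarter_root_itv D : 0 < D < 1 -> 0 < quarter_root D < 1.
Proof.
move=> /andP[D0 D1]; rewrite !sqrtr_gt0 D0/=.
by rewrite -[ltRHS]sqrtr1 ltr_sqrt// -[ltRHS]sqrtr1 ltr_sqrt.
Qed.

Let c_itv e : 0 < e < 1 -> 0 < c e < 2^-1.
Proof.
move=> /andP[e0 e1]; rewrite mulr_gt0 ?exprn_gt0//=.
have e31 : e ^+ 3 < 1 by rewrite exprn_ilt1// ltW.
by apply: lt_le_trans kappa_le; rewrite gtr_pMr.
Qed.

Let denom_gt0 e : 0 < e < 1 -> 0 < 1 - c e ^+ 2 + e ^+ 4 * (1 + c e) * l1.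
Proof.
move=> e01; have /andP[c0 c1] := c_itv e01; have /andP[e0 e1] := e01.
apply: ltr_pwDl.
  by rewrite subr_gt0 exprn_ilt1 ?ltW// (lt_trans c1)// invf_lt1 ?ltr1n.
by rewrite !mulr_ge0 ?exprn_ge0 ?ltW// addr_gt0.
Qed.

Let numer_gt0 e : 0 < e < 1 -> 0 < lam + c e * (l1 - l2) - kappa ^+ 2 * e ^+ 2.
Proof.
move=> e01; have /andP[c0 c1] := c_itv e01; have /andP[e0 e1] := e01.
have l12 : 0 < l1 - l2 by move: lam_gt0 d2_gt0; rewrite /lam; lra.
have : 0 < c e * (l1 - l2) by rewrite mulr_gt0.
have : kappa ^+ 2 * e ^+ 2 <= kappa ^+ 2.
  by rewrite ler_piMr ?sqr_ge0// exprn_ile1// ltW.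
by move: kappa2_lt; lra.
Qed.

Let alpha_gt0 D : 0 < D < 1 -> 0 < alpha D.
Proof.
move=> /quarter_root_itv e01; rewrite lt_min !divr_gt0 ?denom_gt0 ?numer_gt0//.
have /andP[c0 _] := c_itv e01; case/andP: e01 => e0 _.
by rewrite mulr_gt0// addr_gt0.
Qed.

Let rate1_cvg : rate1 e @[e --> 0] --> lam.
Proof.
have cc (e : R) : {for e, continuous c}.
  by apply: continuousM; [exact: cst_continuous|exact: exprn_continuous].
have -> : lam = rate1 0.
  by rewrite /rate1 /c !expr0n/= !mulr0 !mul0r !addr0 !subr0 expr0n/= subr0 divr1.
have ce (e : R) n : {for e, continuous (fun x : R => x ^+ n)}.
  exact: exprn_continuous.
have c2 (e : R) : {for e, continuous (fun x : R => c x ^+ 2)}.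
  by apply: (@continuous_comp R R R c (fun x => x ^+ 2)); [exact: cc|exact: ce].
have k (r e : R) : {for e, continuous (fun _ : R => r)} by exact: cst_continuous.
apply: (@continuousM _ _ (fun e => lam + c e * (l1 - l2) - kappa ^+ 2 * e ^+ 2)
  (fun e => (1 - c e ^+ 2 + e ^+ 4 * (1 + c e) * l1)^-1)).
  apply: continuousB; last by apply: continuousM.
  by apply: continuousD => //; apply: continuousM.
apply: continuousV.
  by rewrite /c !expr0n/= !mulr0 !mul0r !addr0 expr0n/= subr0 oner_neq0.
apply: continuousD; first by apply: continuousB.
apply: continuousM => //; apply: continuousM => //.
by apply: continuousD.
Qed.

Let quarter_root_cvg : quarter_root D @[D --> 0^'+] --> 0.
Proof.
apply: cvg_at_right_filter; rewrite -[X in _ --> X](_ : quarter_root 0 = 0);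
  last first.
  by rewrite /quarter_root !sqrtr0.
apply: (@continuous_comp R R R Num.sqrt Num.sqrt); exact: sqrt_continuous.
Qed.

Let alpha_cvg : alpha D @[D --> 0^'+] --> lam.
Proof.
have r1 : rate1 (quarter_root D) @[D --> 0^'+] --> lam.
  exact: (cvg_comp _ _ quarter_root_cvg rate1_cvg).
have lam1 : 0 < lam + 1 by rewrite addr_gt0.
apply: cvg_trans (r1); apply: near_eq_cvg; near=> D.
have D01 : 0 < D < 1.
  by apply/andP; split; near: D; [exact: nbhs_right_gt|exact: nbhs_right_lt].
have e01 := quarter_root_itv D01; have /andP[e0 _] := e01.
have /andP[c0 c1] := c_itv e01.
apply/esym/min_l; apply: (@le_trans _ _ (lam + 1)).
  by apply/ltW; near: D; apply: cvgr_lt r1 _ _; rewrite ltrDl.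
rewrite /rate2 ler_pdivlMr; last by rewrite mulr_gt0 ?addr_gt0.
have : quarter_root D <= kappa / (2 * (lam + 1)).
  apply/ltW; near: D; apply: cvgr_lt quarter_root_cvg _ _.
  by rewrite divr_gt0 ?mulr_gt0.
rewrite ler_pdivlMr ?mulr_gt0// => H; apply: le_trans H.
rewrite (_ : (lam + 1) * _ =
  quarter_root D * (lam + 1) * (1 + c (quarter_root D))); last by ring.
rewrite [leRHS](_ : _ = quarter_root D * (lam + 1) * 2); last by ring.
rewrite ler_pM2l ?mulr_gt0//.
apply: (@le_trans _ _ (1 + 2^-1)); first by rewrite lerD2l ltW.
lra.
Unshelve. all: by end_near. Qed.

Lemma decay_rate_exists : exists alpha : R -> R,
  [/\ forall D, 0 < D < 1 -> 0 < alpha D,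
      alpha D @[D --> 0^'+] --> lam &
      forall D, 0 < D < 1 -> exists c : R,
        [/\ 0 <= c, 0 < 1 - c ^+ 2 + D * (1 + c) * l1,
          1 + 2 * D * d2 + D * (1 + c) * l2 <=
            (1 - D * alpha D) * (1 - c ^+ 2 + D * (1 + c) * l1) &
          2 * D <= (1 - D * alpha D) * (2 * D * (1 + c))]].
Proof.
exists alpha; split; first exact: alpha_gt0.
  exact: alpha_cvg.
move=> D D01; have e01 := quarter_root_itv D01; have /andP[D0 D1] := D01.
have E4 := quarter_root4 D0; set e := quarter_root D in e01 E4 *.
have /andP[c0 c1] := c_itv e01; have dp := denom_gt0 e01; rewrite E4 in dp.
have /andP[e0 _] := e01.
exists (c e); split => //; first exact: ltW.
- rewrite mulrBl mul1r lerBrDr -lerBrDl.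
  have : alpha D * (1 - c e ^+ 2 + D * (1 + c e) * l1) <=
      lam + c e * (l1 - l2) - kappa ^+ 2 * e ^+ 2.
    rewrite -ler_pdivlMr// ge_min /rate1 -/e E4 lexx//.
  move=> /(ler_wpM2l (ltW D0)); rewrite mulrA => /le_trans; apply.
  rewrite (_ : D * (_ - _) = D * (lam + c e * (l1 - l2)) - c e ^+ 2);
    last first.
    by rewrite /c -{1 2}E4; ring.
  by rewrite /lam; lra.
- have : alpha D * (e * (1 + c e)) <= kappa.
    by rewrite -ler_pdivlMr ?mulr_gt0 ?addr_gt0// ge_min /rate2 -/e lexx orbT.
  have e3 : 0 <= e ^+ 3 by rewrite exprn_ge0// ltW.
  move=> /(ler_wpM2l e3) H.
  have {}H : D * alpha D * (1 + c e) <= c e.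
    rewrite (_ : D * _ * _ = e ^+ 3 * (alpha D * (e * (1 + c e)))).
      by rewrite [leRHS]mulrC.
    by rewrite -{1}E4; ring.
  have := ler_wpM2l (ltW D0) H.
  by move: D0; lra.
Qed.
End decay_rate.

Theorem theorem5p3 (R : realType) (d m : nat) (d_gt0 : (0 < d)%N) (m_gt0 : (0 < m)%N)
  (b : 'cV[R]_d -> prob2 R d -> 'cV[R]_d)
  (sigma : 'cV[R]_d -> prob2 R d -> 'M[R]_(d, m))
  (b_borel : borel_coef b) (sigma_borel : borel_coef sigma)
  (b_lip : loc_lipschitz b) (sigma_lip : loc_lipschitz sigma)
  (* (i) *)
  (cond_i : exists K1 K2 : R, [/\ 0 < K1, 0 < K2 &
     forall (x y : 'cV[R]_d) (mu nu : prob2 R d),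
       2 * dotp (x - y) (b x mu - b y nu) + fnorm (sigma x mu - sigma y nu) ^+ 2
         <= - K1 * fnorm (x - y) ^+ 2 + K2 * wass2 mu nu ^+ 2])
  (* (ii) *)
  (cond_ii : exists C : R, 0 < C /\
     forall mu : prob2 R d, fnorm (b 0 mu) + fnorm (sigma 0 mu) <= C)
  (* (iii) *)
  (sigma1 : 'cV[R]_d -> 'M[R]_(d, m)) (sigma2 : prob2 R d -> 'M[R]_(d, m))
  (sigma_split : forall x mu, sigma x mu = sigma1 x + sigma2 mu)
  (l1 l2 d2 p0 : R)
  (l1_gt0 : 0 < l1) (l2_gt0 : 0 < l2) (d2_gt0 : 0 < d2) (p0_ge3 : 3 <= p0)
  (cond_iii : forall (x : 'cV[R]_d) (mu : prob2 R d),
     2 * dotp x (b x mu) + (p0 - 1) * fnorm (sigma1 x) ^+ 2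
       <= - l1 * fnorm x ^+ 2 + l2 * moment2 mu ^+ 2)
  (sigma2_bound : forall mu : prob2 R d,
     fnorm (sigma2 mu) ^+ 2 <= d2 * moment2 mu ^+ 2)
  (l1_large : l1 > l2 + 2 * d2) :
  exists alpha : R -> R,
  [/\ forall D : R, 0 < D < 1 -> 0 < alpha D,
      alpha D @[D --> 0^'+] --> l1 - l2 - 2 * d2 &
      forall (disp : measure_display) (T : measurableType disp)
        (P : probability T R) (F : R -> set (set T))
        (X0 : T -> 'cV[R]_d) (W : R -> T -> 'cV[R]_m)
        (N : nat) (N_gt0 : (0 < N)%N)
        (Xj : 'I_N -> T -> 'cV[R]_d) (Wj : 'I_N -> R -> T -> 'cV[R]_m),
      usual_conditions P F ->
      initial_condition P F X0 ->
      (* square-integrability of the initial diffusion coefficient: not spelled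
         out in the text, but the conclusion fails without it (see the notes) *)
      ('E_P[fun w => (fnorm (sigma1 (X0 w)) ^+ 2)%R] < +oo)%E ->
      brownian_motion P F W ->
      independent_copies P Xj Wj X0 W ->
      (forall j, measurable_for (F 0) (Xj j)) ->
      (forall j, brownian_motion P F (Wj j)) ->
      forall D : R, stepsize D -> 0 < D < 1 ->
      forall Z : nat -> 'I_N -> T -> 'cV[R]_d,
      backward_euler P F b sigma N_gt0 Xj Wj D Z ->
      forall j : 'I_N,
      (limn_esup (fun k : nat =>
         ((k%:R * D)^-1)%:E * lne 'E_P[fun w => (fnorm (Z k j w) ^+ 2)%R])
       <= (- alpha D)%:E)%E].
Proof.
have lam_gt0 : 0 < l1 - l2 - 2 * d2 by lra.
have [alpha [alpha_gt0 alpha_cvg rate]] := decay_rate_exists l1_gt0 d2_gt0 lam_gt0.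
exists alpha; split => //.
move=> disp T P F X0 W N N_gt0 Xj Wj UF IC S0 BW IJ FXj BWj D _ D01 Z bem j.
have [c [c_ge0 A_gt0 qA qB]] := rate D D01.
have [D0 _] := andP D01.
have [K1 [K2 [_ K2_gt0 Hi]]] := cond_i.
have sigma1_cont i l : continuous (fun x => sigma1 x i l).
  exact: (sigma1_coord_continuous sigma_split).
have sigma2_cont i l : continuous
    (fun M : 'M[R]_(d, N) => sigma2 (empirical N_gt0 (fun n => col n M)) i l).
  exact: (sigma2_empirical_continuous sigma_split K2_gt0 Hi).
have mF t (X : T -> 'cV[R]_d) : 0 <= t -> measurable_for (F t) X ->
    measurable_fun setT (X : T -> euclid R d).
  move=> t0 FX _ B mB; rewrite setTI; apply: (filtration_measurable UF t0).
  exact: FX.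
have mfnorm : measurable_fun setT (fun x : euclid R d => fnorm (x : 'cV[R]_d) ^+ 2).
  by apply/measurable_EFinP; exact: measurable_fnorm_sq.
have msigma1 : measurable_fun setT
    (fun x : euclid R d => fnorm (sigma1 (x : 'cV[R]_d)) ^+ 2).
  apply: measurable_funX.
  apply: (measurable_continuous_comp
    (X := fun x : euclid R d => sigma1 (x : 'cV[R]_d))).
    by move=> i l; apply: (@continuous_measurable_mx _ _ _ (fun x => sigma1 x i l)).
  exact: continuous_fnorm.
have [FX0 _ X0p] := IC; have mX0 := mF _ _ (lexx 0) FX0.
have init (f : euclid R d -> R) :
    measurable_fun setT f -> (forall x, 0 <= f x) ->
    ('E_P[fun w => f (X0 w)] < +oo)%E ->
    forall i, P.-integrable setT (EFin \o (fun w => f (Z 0%N i w))).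
  move=> mf f0 fX0 i.
  have fX0i : P.-integrable setT (EFin \o (f \o X0)).
    apply/integrableP; split; first by apply/measurable_EFinP;
      exact: measurableT_comp.
    move: fX0; rewrite unlock; apply: le_lt_trans; apply: ge0_le_integral => //.
    - by apply/measurable_EFinP; apply: measurableT_comp => //;
        apply: measurableT_comp.
    - by apply/measurable_EFinP; exact: (measurableT_comp mf mX0).
    - by move=> w _ /=; rewrite ger0_norm.
  have iXj := same_law_integrable mX0 (mF _ _ (lexx 0) (FXj i)) (IJ.1 i) mf f0 fX0i.
  case: bem => FZ Z0 _.
  have mZ : measurable_fun setT (Z 0%N i : T -> euclid R d).
    by apply: (mF _ _ _ (FZ 0%N i)); rewrite mul0r.
  apply: (ae_le_integrable _ _ iXj _).1 => //;
    first exact: (measurableT_comp mf mZ).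
  by apply: filterS (Z0 i) => w /= ->.
have iZ0 := init _ mfnorm (fun x => sqr_ge0 _).
have iS0 := init _ msigma1 (fun x => sqr_ge0 _) S0.
have {}iZ0 : forall i,
    P.-integrable setT (EFin \o (fun w => fnorm (Z 0%N i w) ^+ 2)).
  apply: iZ0; have := X0p 2 (lexx _); rewrite unlock.
  by under eq_integral do rewrite (powR_mulrn 2) ?fnorm_ge0//.
have q_ge0 : 0 <= 1 - D * alpha D.
  have : 0 < (1 - D * alpha D) * (2 * D * (1 + c)).
    by apply: lt_le_trans qB; rewrite mulr_gt0.
  have B0 : 0 < 2 * D * (1 + c) by rewrite !mulr_gt0// ltr_wpDr.
  by rewrite (pmulr_lgt0 _ B0) => /ltW.
have integrableZ k := (scheme_integrable sigma_split
  p0_ge3 cond_iii sigma2_bound sigma1_cont sigma2_cont UF BWj D0 bem c_ge0 A_gt0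
  iZ0 iS0 k j).1.
have [V0 decay] : exists V0, forall k,
    \int[P]_w (fnorm (Z k j w) ^+ 2) <= V0 * (1 - D * alpha D) ^+ k.
  by eexists => k; exact: (scheme_decay sigma_split
    p0_ge3 cond_iii sigma2_bound sigma1_cont sigma2_cont UF BWj D0 bem c_ge0 A_gt0
    iZ0 iS0 qA qB).
rewrite (_ : (fun k => _) = fun k => (((k%:R * D)^-1)%:E *
    lne (\int[P]_w (fnorm (Z k j w) ^+ 2))%:E)%E); last first.
  apply/funext => k; rewrite unlock fineK//; apply: integrable_fin_num => //.
  exact: integrableZ.
have V0_ge0 : 0 <= V0.
  have := decay 0%N; rewrite expr0 mulr1; apply: le_trans.
  by apply: Rintegral_ge0 => w _; exact: sqr_ge0.
apply: (@limn_esup_lne_le _ _ V0) => // k; apply: le_trans (decay k) _.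
rewrite ler_wpM2l// lerXn2r ?nnegrE ?expR_ge0//.
by rewrite mulrC -[1 - _]/(1 + _) expR_ge1Dx.
Qed.
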